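(* For each integer $n\ge 3$, let $\{G_m\}_{0\le m\le\binom n2}$ be the random graph process on the vertex set $[n]=\{1,\dots,n\}$, and let $\tau=\tau_2$ be the smallest $m$ such that the minimum degree satisfies $\delta(G_m)\ge 2$. Then, with high probability (i.e. with probability tending to $1$ as $n\to\infty$), the graph $G_\tau$ is globally rigid in $\mathbb{R}$.
   Context: Random graph process: $G_0$ is the empty graph on $[n]$, and for each $i\ge 1$, $G_i$ is obtained from $G_{i-1}$ by adding one new edge chosen uniformly at random among the pairs of vertices not yet joined by an edge. Global rigidity in $\mathbb{R}$ (injective version): a simple graph $G=(V,E)$ is globally rigid in $\mathbb{R}$ if for every two injective functions $f,g:V\to\mathbb{R}$ satisfying $|f(x)-f(y)|=|g(x)-g(y)|$ for every edge $xy\in E$, we also have $|f(x)-f(y)|=|g(x)-g(y)|$ for every pair $x,y\in V$. *)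

(* Defs.v *)
From HB Require Import structures.
From mathcomp Require Import all_boot all_order all_algebra.
From mathcomp Require Import all_classical all_reals all_analysis.

Set Implicit Arguments.
Unset Strict Implicit.
Unset Printing Implicit Defensive.

Import Order.TTheory GRing.Theory Num.Theory.
Import numFieldNormedType.Exports.

Local Open Scope ring_scope.

Definition edge (n : nat) : finType := {e : {set 'I_n} | #|e| == 2}.

(* Simple graphs on the vertex set 'I_n, given by their edge sets. *)
Definition graph (n : nat) : finType := {set edge n}.

Definition adj (n : nat) (G : graph n) (x y : 'I_n) : bool :=
  [exists e in G, val e == [set x; y]%SET].

Definition degree (n : nat) (G : graph n) (x : 'I_n) : nat :=
  #|[set y | adj G x y]%SET|.

(* The neutral value n is never attained by a degree, so it does not affect
   the minimum when n > 0. *)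
Definition min_degree (n : nat) (G : graph n) : nat :=
  \big[minn/n]_(x : 'I_n) degree G x.

Definition globally_rigid (R : realType) (n : nat) (G : graph n) : Prop :=
  forall f g : 'I_n -> R, injective f -> injective g ->
    (forall x y, adj G x y -> `|f x - f y| = `|g x - g y|) ->
    forall x y, `|f x - f y| = `|g x - g y|.

(* Probability that adding to G an edge chosen uniformly among the pairs that
   are not edges of G produces H. *)
Definition step_prob (R : realType) (n : nat) (G H : graph n) : R :=
  \sum_(e in ~: G | H == e |: G) (#|~: G|%:R)^-1.

(* Probability that the first k + 1 graphs of the process are
   g 0, ..., g k. *)
Definition path_prob (R : realType) (n k : nat)
    (g : {ffun 'I_k.+1 -> graph n}) : R :=
  (g ord0 == finset.set0)%:R *
  \prod_(i < k) step_prob R (g (widen_ord (leqnSn k) i)) (g (lift ord0 i)).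

Definition trajectory (n : nat) : finType :=
  {ffun 'I_('C(n, 2)).+1 -> graph n}.

Definition process_prob (R : realType) (n : nat) (A : set (trajectory n)) : R :=
  \sum_(g | g \in A) path_prob R g.

(* The first time at which the minimum degree is at least k; when there is no
   such time, which for k = 2 and n >= 3 has probability 0, it takes the junk
   value 'C(n, 2). *)
Definition hitting_time (n k : nat) (g : trajectory n) : 'I_('C(n, 2)).+1 :=
  [arg min_(m < ord_max | (k <= min_degree (g m))%N) (m : nat)]%N.

Lemma card_edge (n : nat) : #|edge n| = 'C(n, 2).
Proof.
rewrite card_sub -[in RHS](card_ord n) -card_draws.
by apply: eq_card => e; rewrite !inE.
Qed.

Lemma step_prob_sum (R : realType) (n : nat) (G : graph n) :
  (#|G| < 'C(n, 2))%N -> \sum_H step_prob R G H = 1.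
Proof.
move=> GN; rewrite /step_prob.
rewrite (exchange_big_dep (mem (~: G)%SET)) //=; last by move=> H e _ /andP[].
rewrite (eq_bigr (fun=> (#|~: G|%SET%:R)^-1)) => [|e eG]; last first.
  rewrite (eq_bigl (pred1 (e |: G)%SET)) ?big_pred1_eq// => H.
  by rewrite /= eG.
rewrite sumr_const -[_ *+ #|_|]mulr_natr mulVf// pnatr_eq0 cardsCs finset.setCK.
by rewrite card_edge -lt0n subn_gt0.
Qed.

Lemma step_prob_card (R : realType) (n : nat) (G H : graph n) :
  step_prob R G H != 0 -> #|H| = #|G|.+1.
Proof.
apply: contra_neq_eq => HG; rewrite /step_prob big1// => e /andP[].
by rewrite inE => eG /eqP HE; rewrite HE cardsU1 eG eqxx in HG.
Qed.

Lemma path_prob_card (R : realType) (n k : nat) (g : {ffun 'I_k.+1 -> graph n}) :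
  path_prob R g != 0 -> forall i, #|g i| = i.
Proof.
rewrite /path_prob mulf_eq0 negb_or prodf_seq_neq0 => /andP[g0 /allP gs] [i].
elim: i => [|i IH] ik.
  have -> : Ordinal ik = ord0 by apply: val_inj.
  by move: g0; case: (g ord0 =P _) => [-> _|]; rewrite ?cards0 ?eqxx.
have ik' : (i < k)%N by [].
have := gs (Ordinal ik') (mem_index_enum _) => /= /step_prob_card.
rewrite (_ : lift _ _ = Ordinal ik); last exact: val_inj.
move=> ->; congr S; rewrite -[RHS](IH (ltnW ik)).
by congr (#|pred_of_set (g _)|); exact: val_inj.
Qed.

Lemma path_prob_sum (R : realType) (n k : nat) : (k <= 'C(n, 2))%N ->
  \sum_(g : {ffun 'I_k.+1 -> graph n}) path_prob R g = 1.
Proof.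
elim: k => [_|k IH kN].
  rewrite (bigD1 [ffun=> finset.set0])//= big1 => [|g g0].
    by rewrite /path_prob ffunE eqxx big_ord0 mulr1 addr0.
  rewrite /path_prob big_ord0 mulr1 -[RHS]/(false%:R); congr (nat_of_bool _)%:R.
  apply: contraNF g0 => /eqP g0; apply/eqP/ffunP => i.
  by rewrite ffunE ord1.
pose ext (p : {ffun 'I_k.+1 -> graph n} * graph n) : {ffun 'I_k.+2 -> graph n} :=
  [ffun i => if unlift ord_max i is Some j then p.1 j else p.2].
pose res (g : {ffun 'I_k.+2 -> graph n}) :=
  ([ffun j => g (lift ord_max j)] : {ffun 'I_k.+1 -> graph n}, g ord_max).
have extK : cancel ext res.
  move=> [g H]; rewrite /res ffunE unlift_none; congr pair.
  by apply/ffunP => j; rewrite !ffunE liftK.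
have resK : cancel res ext.
  move=> g; apply/ffunP => i; rewrite ffunE.
  by case: unliftP => [j ->|->]//=; rewrite ffunE.
rewrite (reindex ext) /=; last by exists res => ? _; [exact: extK|exact: resK].
rewrite -(pair_bigA _ (fun g H => path_prob R (ext (g, H)))) /=.
rewrite -[RHS](IH (ltnW kN)); apply: eq_bigr => g _.
have E H : path_prob R (ext (g, H)) = path_prob R g * step_prob R (g ord_max) H.
  have extl (i : 'I_k.+2) (j : 'I_k.+1) : i = j :> nat -> ext (g, H) i = g j.
    move=> ij; have -> : i = lift ord_max j.
      by apply: val_inj; rewrite /= /bump leqNgt ltn_ord.
    by rewrite ffunE liftK.
  rewrite /path_prob big_ord_recr /= mulrA (extl _ ord0)//.
  rewrite (extl _ ord_max)//; congr (_ * _ * _).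
    by apply: eq_bigr => i _; congr step_prob; exact: extl.
  congr step_prob; rewrite (_ : lift _ _ = ord_max); last exact: val_inj.
  by rewrite ffunE unlift_none.
under eq_bigr do rewrite E.
rewrite -big_distrr /=; have [->|g0] := eqVneq (path_prob R g) 0.
  by rewrite mul0r.
by rewrite step_prob_sum ?mulr1// (path_prob_card g0).
Qed.

Lemma process_probT (R : realType) (n : nat) :
  process_prob R [set: trajectory n]%classic = 1.
Proof.
rewrite -[RHS](path_prob_sum R (leqnn 'C(n, 2))).
by apply: eq_bigl => g; rewrite in_setT.
Qed.

(* Main.v *)
(* Two injective realisations f, g with the same edge lengths yield u = f - g
   and v = f + g such that every edge is constant for u or for v, while (u, v)
   is injective.  Cutting the plane at a quantile of u and one of v leaves no
   edge between opposite quadrants, so if any two disjoint sets of d vertices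
   are joined by an edge, then some level set of u or of v misses fewer than 4d
   vertices.  Every vertex of the complement W of that level set has at most one
   neighbour outside W, hence at least one in W when the minimum degree is 2.

   Let a = (7/16) n ln n and b = 2 n ln n.  With high probability G_a has an
   isolated vertex (second moment) and G_b has minimum degree at least 2, so
   a <= tau <= b, and any two disjoint sets of n/64 vertices are joined by an
   edge of G_a.  A nonempty W as above has |W| <= n/16, at most |W| edges of G_a
   leave it, and each of its vertices has a neighbour in W in G_b, which costs at
   least |W|/2 edges.  For fixed W and fixed choices of neighbours this has
   probability at most (C n^(-43/40))^|W|, which beats the number
   C(n, |W|) |W|^|W| <= (e n)^|W| of choices. *)
Require Import Defs.
From mathcomp Require Import all_boot all_order all_algebra.
From mathcomp Require Import all_classical all_reals all_analysis.
From mathcomp Require Import lra ring zify.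

Set Implicit Arguments.
Unset Strict Implicit.
Unset Printing Implicit Defensive.

Import Order.TTheory GRing.Theory Num.Theory.
Import numFieldNormedType.Exports.

Local Open Scope ring_scope.

(** * Path measure of the process: one-step averages and supermartingales *)

Lemma step_prob_ge0 (R : realType) n (G H : graph n) : 0 <= step_prob R G H.
Proof. by apply: sumr_ge0 => e _; rewrite invr_ge0 ler0n. Qed.

Lemma path_prob_ge0 (R : realType) n k (g : {ffun 'I_k.+1 -> graph n}) :
  0 <= path_prob R g.
Proof.
by apply: mulr_ge0; rewrite ?ler0n// prodr_ge0// => i _; exact: step_prob_ge0.
Qed.

(** Each missing edge determines one successor graph; the one-step expectations below thus become
    averages over missing edges. *)
Lemma sum_step_prob (R : realType) n (G : graph n) (P : pred (graph n))
    (h : graph n -> R) :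
  \sum_(H | P H) step_prob R G H * h H =
  (#|~: G|%SET%:R)^-1 * \sum_(e in ~: G | P (e |: G)%SET) h (e |: G)%SET.
Proof.
rewrite /step_prob big_distrr /=.
under eq_bigr do rewrite big_distrl /=.
rewrite (exchange_big_dep (mem (~: G)%SET)) //=; last first.
  by move=> H e _ /andP[].
rewrite [RHS]big_mkcondr /=; apply: eq_bigr => e eG.
rewrite (eq_bigl (fun H => (H == (e |: G)%SET) && P (e |: G)%SET)); last first.
  by move=> H /=; rewrite eG /=; case: eqP => [->|]; rewrite ?andbT ?andbF.
by case: ifP => Pe; rewrite ?(eq_bigl _ _ (fun=> andbT _)) ?big_pred1_eq//;
  rewrite big_pred0// => H; rewrite andbF.
Qed.

Definition path_rcons n k (g : {ffun 'I_k.+1 -> graph n}) (H : graph n) :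
    {ffun 'I_k.+2 -> graph n} :=
  [ffun i => if unlift ord_max i is Some j then g j else H].

Lemma path_rconsE n k (g : {ffun 'I_k.+1 -> graph n}) H (i : 'I_k.+2)
    (j : 'I_k.+1) : i = j :> nat -> path_rcons g H i = g j.
Proof.
move=> ij; have -> : i = lift ord_max j.
  by apply: val_inj; rewrite /= /bump leqNgt ltn_ord.
by rewrite ffunE liftK.
Qed.

Lemma path_rcons_max n k (g : {ffun 'I_k.+1 -> graph n}) H :
  path_rcons g H ord_max = H.
Proof. by rewrite ffunE unlift_none. Qed.

Lemma path_prob_rcons (R : realType) n k (g : {ffun 'I_k.+1 -> graph n}) H :
  path_prob R (path_rcons g H) = path_prob R g * step_prob R (g ord_max) H.
Proof.
rewrite /path_prob big_ord_recr /= mulrA (@path_rconsE _ _ _ _ _ ord0)//.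
rewrite (@path_rconsE _ _ _ _ _ ord_max)//; congr (_ * _ * _).
  by apply: eq_bigr => i _; congr step_prob; exact: path_rconsE.
congr step_prob; rewrite (_ : lift _ _ = ord_max); last exact: val_inj.
exact: path_rcons_max.
Qed.

Lemma sum_path_rcons (R : realType) n k (P : pred {ffun 'I_k.+2 -> graph n})
    (F : {ffun 'I_k.+2 -> graph n} -> R) :
  \sum_(g | P g) F g =
  \sum_(g : {ffun 'I_k.+1 -> graph n}) \sum_(H | P (path_rcons g H))
    F (path_rcons g H).
Proof.
rewrite (pair_big_dep xpredT (fun g H => P (path_rcons g H))
  (fun g H => F (path_rcons g H))) /=.
rewrite (reindex (fun p => path_rcons p.1 p.2))//=.
exists (fun g : {ffun 'I_k.+2 -> graph n} =>
    ([ffun j => g (lift ord_max j)] : {ffun 'I_k.+1 -> graph n}, g ord_max)).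
  move=> [g H] _ /=; rewrite path_rcons_max; congr pair.
  by apply/ffunP => j; rewrite !ffunE liftK.
move=> g _; apply/ffunP => i; rewrite ffunE.
by case: unliftP => [j ->|->]//=; rewrite ffunE.
Qed.

(* The process is killed when it leaves phi; h is a supermartingale for the
   killed process. *)
Lemma path_prob_super (R : realType) n k (phi : nat -> pred (graph n))
    (h : nat -> graph n -> R) :
  (forall i (G : graph n), (i < k)%N -> #|G| = i -> phi i G ->
     \sum_(H | phi i.+1 H) step_prob R G H * h i.+1 H <= h i G) ->
  phi 0%N finset.set0 ->
  \sum_(g : {ffun 'I_k.+1 -> graph n} | [forall i : 'I_k.+1, phi i (g i)])
    path_prob R g * h k (g ord_max) <= h 0%N finset.set0.
Proof.
move=> hS phi0; elim: k hS => [_|k IH hS].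
  rewrite (bigD1 [ffun=> finset.set0])/=; last first.
    by apply/forallP => i; rewrite ord1 ffunE.
  rewrite big1 => [|g /andP[_ g0]].
    by rewrite addr0 /path_prob !ffunE eqxx big_ord0 !mul1r.
  suff -> : path_prob R g = 0 by rewrite mul0r.
  rewrite /path_prob; case: eqP => [g00|]; last by rewrite mul0r.
  case/negP: g0; apply/eqP/ffunP => i.
  by rewrite ord1 ffunE g00.
apply: le_trans (IH (fun i G ik => hS i G (ltnW ik))).
rewrite sum_path_rcons [leRHS]big_mkcond /=; apply: ler_sum => g _.
case: forallP => [gphi|gphi]; last first.
  rewrite big_pred0// => H; apply/negP => /forallP gH; apply: gphi => i.
  have := gH (widen_ord (leqnSn _) i).
  by rewrite (@path_rconsE _ _ _ _ _ i).
rewrite (eq_bigl (phi k.+1)); last first.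
  move=> H; apply/forallP/idP => [/(_ ord_max)|phiH i].
    by rewrite path_rcons_max.
  rewrite ffunE; case: unliftP => [j ->|->]//=.
  rewrite (_ : bump k.+1 j = j); first exact: gphi.
  by rewrite /bump leqNgt ltn_ord.
under eq_bigr do rewrite path_prob_rcons path_rcons_max -mulrA.
rewrite -big_distrr /=.
(* A path of positive probability has exactly [k] edges at time [k], the cardinality that the
   one-step hypothesis asks for. *)
have [g0|/path_prob_card gk] := eqVneq (path_prob R g) 0; first by rewrite g0 !mul0r.
apply: ler_wpM2l; first exact: path_prob_ge0.
by apply: hS (gk _) (gphi ord_max).
Qed.

Lemma path_prob_mono (R : realType) n k (g : {ffun 'I_k.+1 -> graph n}) :
  path_prob R g != 0 -> forall i j : 'I_k.+1, (i <= j)%N -> g i \subset g j.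
Proof.
rewrite /path_prob mulf_eq0 negb_or prodf_seq_neq0 => /andP[_ /allP gs] i [j].
elim: j => [|j IH] jk ij.
  by rewrite (_ : i = Ordinal jk)//; apply: val_inj; apply/eqP; rewrite -leqn0.
move: ij; rewrite leq_eqVlt => /orP[/eqP ij|ij].
  by rewrite (_ : i = Ordinal jk)//; exact: val_inj.
have jk' : (j < k)%N by [].
apply: (fintype.subset_trans (IH (ltnW jk) ij)).
have := gs (Ordinal jk') (mem_index_enum _) => /=.
rewrite (_ : lift _ _ = Ordinal jk); last exact: val_inj.
rewrite (_ : widen_ord _ _ = Ordinal (ltnW jk)); last exact: val_inj.
apply: contraR => gg; rewrite /step_prob big1// => e /andP[_ /eqP E].
by rewrite E finset.subsetUr in gg.
Qed.

(** * Probability that the process avoids or collects given edges *)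

Definition pr (R : realType) n (P : pred (trajectory n)) : R :=
  \sum_(g | P g) path_prob R g.

Lemma eq_pr (R : realType) n (P Q : pred (trajectory n)) :
  (forall g, path_prob R g != 0 -> P g = Q g) -> pr R P = pr R Q.
Proof.
move=> PQ; rewrite /pr big_mkcond [RHS]big_mkcond; apply: eq_bigr => g _.
by have [->|/PQ ->//] := eqVneq (path_prob R g) 0; rewrite !if_same.
Qed.

Lemma card_nonedges n (G : graph n) : #|~: G|%SET = ('C(n, 2) - #|G|)%N.
Proof. by rewrite cardsCs finset.setCK card_edge. Qed.

(** While [F] is avoided, [#|F|] of the ['C(n, 2) - i] edges missing at time [i] lie in [F], so the
    product of the remaining factors is a martingale for the process killed on hitting [F]. Equality
    comes from [path_prob_super] applied to [h] and to [- h]. *)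
Lemma prob_disjoint (R : realType) n (F : {set edge n}) (m : 'I_('C(n, 2)).+1) :
  pr R (fun g : trajectory n => [disjoint F & g m]) =
  \prod_(0 <= i < m) (1 - #|F|%:R / ('C(n, 2) - i)%N%:R).
Proof.
pose phi i (H : graph n) := (i <= m)%N ==> [disjoint F & H].
pose h i (H : graph n) : R := \prod_(i <= j < m) (1 - #|F|%:R / ('C(n, 2) - j)%N%:R).
have hS i (G : graph n) : (i < 'C(n, 2))%N -> #|G| = i -> phi i G ->
    \sum_(H | phi i.+1 H) step_prob R G H * h i.+1 H = h i G.
  move=> iN Gi phiG; rewrite sum_step_prob card_nonedges Gi.
  have N0 : ('C(n, 2) - i)%N%:R != 0 :> R by rewrite pnatr_eq0 subn_eq0 -ltnNge.
  rewrite sumr_const -[X in _ * X]mulr_natl /h.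
  have [im|mi] := ltnP i m; last first.
    rewrite !big_geq ?(leq_trans mi)// mulr1.
    rewrite (_ : #|_| = ('C(n, 2) - i)%N) ?mulVf//.
    rewrite -Gi -card_nonedges; apply: eq_card => e.
    by rewrite unfold_in /= Gi /phi (leq_gtF mi)/= andbT.
  rewrite [RHS]big_ltn// mulrA; congr (_ * _).
  have /implyP/(_ (ltnW im)) FG := phiG.
  have FsG : F \subset ~: G by rewrite -finset.disjoints_subset.
  have FM : (#|F| <= 'C(n, 2) - i)%N by rewrite -Gi -card_nonedges subset_leq_card.
  rewrite (_ : #|_| = ('C(n, 2) - i - #|F|)%N).
    by rewrite (natrB _ FM) mulrBr mulVf// [_^-1 * _]mulrC.
  rewrite -Gi -card_nonedges -(cardsID F (~: G)%SET) (finset.setIidPr FsG) addKn.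
  apply: eq_card => e; rewrite unfold_in /= Gi /phi im /= [RHS]finset.in_setD [RHS]andbC; congr (_ && _).
  apply/idP/idP; first by move=> /disjointFl -> //; rewrite !inE eqxx.
  move=> eF; rewrite disjoint_sym -setI_eq0 finset.setIUl finset.setU_eq0 !setI_eq0 disjoints1 eF.
  by rewrite disjoint_sym.
have phi0 : phi 0%N finset.set0 by rewrite /phi -setI_eq0 finset.setI0 eqxx.
have E : pr R (fun g : trajectory n => [disjoint F & g m]) =
    pr R (fun g : trajectory n => [forall i : 'I_('C(n, 2)).+1, phi i (g i)]).
  apply: eq_pr => g /path_prob_mono gm; apply/idP/forallP => [Fg i|/(_ m)].
    by apply/implyP => im; apply: disjointWr Fg; exact: gm.
  by rewrite /phi leqnn.
have h1 g : h 'C(n, 2) g = 1 by rewrite /h big_geq// -ltnS.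
rewrite E; apply/eqP; rewrite eq_le; apply/andP; split.
  have hle i (G : graph n) : (i < 'C(n, 2))%N -> #|G| = i -> phi i G ->
      \sum_(H | phi i.+1 H) step_prob R G H * h i.+1 H <= h i G.
    by move=> iN Gi Gphi; rewrite hS.
  have := path_prob_super (h := h) hle phi0.
  by under [X in X <= _ -> _]eq_bigr do rewrite h1 mulr1.
have hle i (G : graph n) : (i < 'C(n, 2))%N -> #|G| = i -> phi i G ->
    \sum_(H | phi i.+1 H) step_prob R G H * - h i.+1 H <= - h i G.
  by move=> iN Gi Gphi; under eq_bigr do rewrite mulrN; rewrite sumrN hS.
have := path_prob_super (h := fun i H => - h i H) hle phi0.
by under [X in X <= _ -> _]eq_bigr do rewrite h1 mulrN1; rewrite sumrN lerN2.
Qed.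

(** These are the first two terms of the binomial expansion; in [step_bound] the linear one pays for
    the chance that the next edge lies in [A]. *)
Lemma exprD_ge (R : realType) (q k : R) (m : nat) : 0 <= q -> 0 <= k ->
  q ^+ m + m%:R * q ^+ m.-1 * k <= (q + k) ^+ m.
Proof.
move=> q0 k0; elim: m => [|m IH]; first by rewrite !mul0r addr0 !expr0.
rewrite [leRHS]exprSr; apply: le_trans (ler_wpM2r (addr_ge0 q0 k0) IH).
have E : m%:R * q ^+ m.-1 * q = m%:R * q ^+ m.
  by case: m {IH} => [|m]; rewrite ?mul0r// -mulrA -exprSr.
rewrite /= mulrDl !mulrDr -exprSr -natr1 !mulrDl mul1r.
rewrite [X in _ <= _ + (X + _)]mulrAC E.
have : 0 <= m%:R * q ^+ m.-1 * k * k by rewrite !mulr_ge0// exprn_ge0.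
by lra.
Qed.

Lemma sum_nonedges (R : realType) n (A F G : {set edge n}) (x y : R) :
  \sum_(e in ~: G) (1 + (e \in A)%:R * x + (e \in F)%:R * y) =
  #|~: G|%SET%:R + #|A :\: G|%SET%:R * x + #|F :\: G|%SET%:R * y.
Proof.
have S (B : {set edge n}) (t : R) :
    \sum_(e in ~: G) (e \in B)%:R * t = #|B :\: G|%SET%:R * t.
  rewrite -big_distrl -natr_sum /= -sum1dep_card big_mkcond /=.
  rewrite [in RHS]big_mkcond /=; congr (_%:R * _); apply: eq_bigr => e _.
  by rewrite !inE; case: (e \in G).
by rewrite !big_split /= !S sumr_const.
Qed.

(** In [step_bound], [x], [y], [p] are [q ^+ m], [q ^+ m.-1], [(q + k) ^+ m], and [f] is
    [(1 - z) * #|F :\: G|]. *)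
Lemma step_bound_algebra (R : realType) (M c f m x y p k : R) :
  0 <= M -> 0 <= c -> 0 <= m * x ->
  x * (M - f) <= x * (c * M) -> m * y * 1 <= m * y * (k * c * M) ->
  x + m * y * k <= p -> x * (M - f) + m * (y - x) <= c * p * M.
Proof.
move=> M0 c0 mx0 xM my xp.
have : c * M * (x + m * y * k) <= c * M * p by rewrite ler_wpM2l ?mulr_ge0.
by lra.
Qed.

(** A new edge of [F] multiplies the weight by [z], on average a factor of at most [c]. A new edge
    of [A] lowers the exponent of [q]; the linear term of [exprD_ge] absorbs this because
    [k * c * M >= 1]. Disjointness keeps the two effects on different edges. *)
Lemma step_bound (R : realType) n (A F G : {set edge n}) (z q k c : R) :
  [disjoint A & F] -> (#|G| < 'C(n, 2))%N -> 0 <= q -> 0 <= k -> 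
  1 - (1 - z) * #|F :\: G|%SET%:R / #|~: G|%SET%:R <= c ->
  1 <= k * c * #|~: G|%SET%:R -> 0 <= c ->
  #|~: G|%SET%:R^-1 *
    (\sum_(e in ~: G) (if e \in F then z else 1) * q ^+ #|A :\: (e |: G)|%SET) <=
  c * (q + k) ^+ #|A :\: G|%SET.
Proof.
move=> AF GN q0 k0 cz kc c0.
set m := #|A :\: G|%SET; set M := #|~: G|%SET%:R : R.
have M0 : 0 < M by rewrite ltr0n card_nonedges subn_gt0.
have E : \sum_(e in ~: G) (if e \in F then z else 1) * q ^+ #|A :\: (e |: G)|%SET =
    q ^+ m * (M - (1 - z) * #|F :\: G|%SET%:R) + m%:R * (q ^+ m.-1 - q ^+ m).
  (* The weight of a missing edge is [z * q ^+ m] on [F], [q ^+ m.-1] on [A] and [q ^+ m] elsewhere,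
     hence affine in the two indicators, as [sum_nonedges] expects. *)
  transitivity (\sum_(e in ~: G) (q ^+ m * (1 + (e \in (finset.set0 : {set edge n}))%:R * 0 +
       (e \in F)%:R * (z - 1)) + (q ^+ m.-1 - q ^+ m) * (1 + (e \in A)%:R * 1 +
       (e \in F)%:R * 0 - 1))).
    apply: eq_bigr => e; rewrite inE => eG.
    have Ae : #|A :\: (e |: G)|%SET = (m - (e \in A))%N.
      rewrite /m (cardsD1 e (A :\: G)%SET) !inE eG /= addKn.
      by apply: eq_card => x; rewrite !inE negb_or andbA.
    rewrite Ae inE; have [eA|eA] := boolP (e \in A).
      rewrite (disjointFr AF)// subn1 /=.
      by move: (q ^+ _) (q ^+ _) => x y; ring.
    by rewrite subn0; case: ifP => _ /=; move: (q ^+ _) (q ^+ _) => x y; ring.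
  rewrite big_split /= -!big_distrr /= sum_nonedges.
  have -> : \sum_(e in ~: G) (1 + (e \in A)%:R * 1 + (e \in F)%:R * 0 - 1) = m%:R :> R.
    by rewrite big_split /= sum_nonedges sumr_const mulNrn /m /M; ring.
  by rewrite -/M mulr0; move: (q ^+ _) (q ^+ _) => x y; ring.
rewrite E mulrC ler_pdivrMr//.
have qm : 0 <= q ^+ m by exact: exprn_ge0.
have qm1 : 0 <= m%:R * q ^+ m.-1 by rewrite mulr_ge0// exprn_ge0.
have M0' := ltW M0.
have mqm : 0 <= m%:R * q ^+ m by rewrite mulr_ge0.
have cM : M - (1 - z) * #|F :\: G|%SET%:R <= c * M.
  by rewrite -ler_pdivrMr// mulrBl divff// gt_eqF.
have B := exprD_ge m q0 k0.
apply: (@step_bound_algebra R M _ _ m%:R (q ^+ m) (q ^+ m.-1) _ k) => //.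
  exact: ler_wpM2l cM.
exact: ler_wpM2l kc.
Qed.

(* The supermartingale weights the graph at time i by [z] per edge of [F]
   present and by [kappa * (b - i)] per edge of [A] still missing. *)
Lemma prob_two_times (R : realType) n (A F : {set edge n})
    (a b : 'I_('C(n, 2)).+1) (w : nat) (z kappa : R) :
  (a <= b)%N -> (0 < b)%N -> (b < 'C(n, 2))%N -> 0 <= z <= 1 ->
  (w <= #|F|)%N -> [disjoint A & F] -> 0 <= kappa ->
  let c := expR (- ((1 - z) * (#|F| - w)%N%:R / 'C(n, 2)%:R)) in
  1 <= kappa * c * ('C(n, 2) - b)%N%:R ->
  z ^+ w * pr R (fun g : trajectory n =>
    (#|F :&: g a| <= w)%N && (A \subset g b)) <=
  c ^+ a * (kappa * b%:R) ^+ #|A|.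
Proof.
move=> ab b0 bN /andP[z0 z1] wF AF k0 c kc.
have N0 : 0 < 'C(n, 2)%:R :> R by rewrite ltr0n (leq_ltn_trans _ bN).
have c0 : 0 <= c by exact: expR_ge0.
have c1 : c <= 1.
  by rewrite /c -[leRHS]expR0 ler_expR oppr_le0 divr_ge0// mulr_ge0// subr_ge0.
pose phi i (H : graph n) := ((i <= a)%N ==> (#|F :&: H| <= w)%N) &&
  ((b <= i)%N ==> (A \subset H)).
(* After time [a] the power of [z] is frozen at [z ^+ w], a lower bound since [z <= 1]. The
   truncated [b - i] is [0] from time [b] on, but there survival makes its exponent [0], and
   [0 ^+ 0] is [1]. *)
pose h i (H : graph n) : R :=
  (if (i <= a)%N then z ^+ #|F :&: H| * c ^+ (a - i) else z ^+ w) *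
  (kappa * (b - i)%N%:R) ^+ #|A :\: H|.
have qS i : (i < b)%N ->
    kappa * (b - i)%N%:R = kappa * (b - i.+1)%N%:R + kappa.
  by move=> ib; rewrite subnS -[in LHS](@prednK (b - i)) ?subn_gt0// -natr1 mulrDr mulr1.
have hS i (G : graph n) : (i < 'C(n, 2))%N -> #|G| = i -> phi i G ->
    \sum_(H | phi i.+1 H) step_prob R G H * h i.+1 H <= h i G.
  move=> iN Gi phiG; rewrite sum_step_prob.
  have MN : #|~: G|%SET = ('C(n, 2) - i)%N by rewrite card_nonedges Gi.
  have GN : (#|G| < 'C(n, 2))%N by rewrite Gi.
  have M0 : 0 < ('C(n, 2) - i)%N%:R :> R by rewrite ltr0n subn_gt0.
  have [bi|ib] := leqP b i.
    move: phiG => /andP[Fw]; rewrite bi /= => AG.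
    have AG0 (H : graph n) : G \subset H -> #|A :\: H|%SET = 0%N.
      move=> GH; apply/eqP; rewrite cards_eq0 finset.setD_eq0.
      exact: fintype.subset_trans GH.
    apply: (@le_trans _ _ (z ^+ w)); last first.
      rewrite /h AG0// expr0 mulr1; case: ifP => // ia.
      have -> : (a - i)%N = 0%N by apply/eqP; rewrite subn_eq0 (leq_trans ab bi).
      by rewrite expr0 mulr1 ler_wiXn2l//; exact: (implyP Fw).
    apply: (@le_trans _ _ (#|~: G|%SET%:R^-1 * \sum_(e in ~: G) z ^+ w)).
      rewrite ler_wpM2l ?invr_ge0// big_mkcondr /= ler_sum// => e _.
      case: ifP => _; last exact: exprn_ge0.
      by rewrite /h ltnNge (leq_trans ab bi)/= AG0 ?finset.subsetUr// expr0 mulr1.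
    by rewrite sumr_const MN -[X in _ * X]mulr_natl mulrA mulVf ?mul1r// gt_eqF.
  set q := kappa * (b - i.+1)%N%:R.
  have q0 : 0 <= q by rewrite mulr_ge0.
  have kcM : 1 <= kappa * c * #|~: G|%SET%:R.
    apply: le_trans kc _; rewrite MN ler_wpM2l ?mulr_ge0// ler_nat.
    by rewrite leq_sub2l// ltnW.
  (* Between the two times only [A] matters: [step_bound] is used with empty [F] and constant
     [1]. *)
  have [ai|ia] := leqP a i.
    have := @step_bound R n A finset.set0 G z q kappa 1.
    rewrite -setI_eq0 finset.setI0 eqxx !finset.set0D cards0 mulr0 mul0r subr0 lexx.
    move=> /(_ isT GN q0 k0 isT); rewrite mulr1 mul1r ler01 => /(_ _ isT) B.
    apply: (@le_trans _ _ (z ^+ w * (q + kappa) ^+ #|A :\: G|%SET)).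
      apply: le_trans (ler_wpM2l (exprn_ge0 w z0) (B _)); last first.
        apply: le_trans kcM _; rewrite ler_wpM2r//.
        by rewrite -[leRHS]mulr1 ler_wpM2l.
      rewrite mulrCA; apply: ler_wpM2l; first by rewrite invr_ge0.
      rewrite big_distrr /= big_mkcondr /= ler_sum// => e eG.
      rewrite inE /= mul1r.
      case: ifP => _; last by rewrite mulr_ge0// exprn_ge0.
      by rewrite /h ltnNge ai.
    rewrite /h -qS//; apply: ler_wpM2r; first by rewrite exprn_ge0// mulr_ge0.
    case: ifP => // ia; have -> : i = a by apply/eqP; rewrite eqn_leq ia ai.
    rewrite subnn expr0 mulr1 ler_wiXn2l//.
    by move: phiG => /andP[/implyP/(_ ia)].
  have FGw : (#|F :&: G|%SET <= w)%N by move: phiG => /andP[/implyP/(_ (ltnW ia))].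
  have B := @step_bound R n A F G z q kappa c AF GN q0 k0 _ kcM c0.
  pose D := z ^+ #|F :&: G| * c ^+ (a - i.+1).
  have D0 : 0 <= D by rewrite mulr_ge0 ?exprn_ge0.
  have -> : h i G = D * (c * (q + kappa) ^+ #|A :\: G|%SET).
    rewrite /h (ltnW ia) qS// -/q (_ : a - i = (a - i.+1).+1)%N ?exprSr//.
      by rewrite /D -!mulrA.
    by rewrite subnSK.
  (* The form of [c] comes from [1 - t <= expR (- t)]: a surviving graph misses at least [#|F| - w]
     edges of [F], out of at most ['C(n, 2)] missing edges. *)
  apply: le_trans (ler_wpM2l D0 (B _)); last first.
    apply: le_trans (expR_ge1Dx _); rewrite lerD2l lerN2 -!mulrA.
    apply: ler_wpM2l; first by rewrite subr_ge0.
    rewrite MN; apply: ler_pM => //.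
      by rewrite ler_nat cardsD leq_sub2l.
    by rewrite lef_pV2 ?posrE// ler_nat leq_subr.
  rewrite mulrCA; apply: ler_wpM2l; first by rewrite invr_ge0.
  rewrite big_distrr /= big_mkcondr /= ler_sum// => e; rewrite inE => eG.
  have -> : h i.+1 (e |: G)%SET =
      D * ((if e \in F then z else 1) * q ^+ #|A :\: (e |: G)|%SET).
    rewrite /h ia /D -/q !mulrA; congr (_ * _).
    rewrite [RHS]mulrAC; congr (_ * _).
    case: ifP => eF; last first.
      rewrite mulr1; congr (_ ^+ #|pred_of_set _|); apply/setP => x; rewrite !inE.
      by case: eqP => [->|//]; rewrite eF.
    rewrite -exprSr; congr (_ ^+ _).
    rewrite (cardsD1 e) !inE eF eqxx add1n; congr _.+1; apply: eq_card => x.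
    by rewrite !inE; case: eqP => [->|//]; rewrite (negbTE eG) andbF.
  case: ifP => // _; rewrite mulr_ge0// mulr_ge0 ?exprn_ge0//.
  by case: ifP.
have phi0 : phi 0%N finset.set0.
  by rewrite /phi finset.setI0 cards0 leqn0 (gtn_eqF b0).
have := path_prob_super hS phi0.
rewrite {2}/h finset.setI0 cards0 expr0 mul1r subn0 finset.setD0 subn0 => hN.
apply: le_trans hN.
rewrite (@eq_pr _ _ _ (fun g : trajectory n =>
    [forall i : 'I_('C(n, 2)).+1, phi i (g i)])).
  rewrite /pr big_distrr /= ler_sum// => g /forallP/(_ ord_max)/andP[_].
  rewrite /= (ltnW bN) /= => Ag.
  rewrite /h leqNgt (leq_ltn_trans ab bN) /=.
  have -> : #|A :\: g ord_max|%SET = 0%N by apply/eqP; rewrite cards_eq0 finset.setD_eq0.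
  by rewrite expr0 mulr1 mulrC.
move=> g /path_prob_mono gm; apply/andP/forallP => [[Fw Ab] i|gphi].
  apply/andP; split; apply/implyP => ii.
    by apply: leq_trans Fw; rewrite subset_leq_card// finset.setIS// gm.
  by apply: fintype.subset_trans (gm _ _ ii).
split; first by have /andP[/implyP/(_ (leqnn _))] := gphi a.
by have /andP[_ /implyP/(_ (leqnn _))] := gphi b.
Qed.

(** This is [prob_two_times] with [A] empty, [w = 0] and [z = 0], where [z ^+ w] is [1]; [kappa] is
    just large enough for the side condition. *)
Lemma prob_disjoint_le (R : realType) n (F : {set edge n})
    (a : 'I_('C(n, 2)).+1) : (0 < a)%N -> (a < 'C(n, 2))%N ->
  pr R (fun g : trajectory n => [disjoint F & g a]) <=
  expR (- (#|F|%:R / 'C(n, 2)%:R * a%:R)).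
Proof.
move=> a0 aN; set c := expR (- ((1 - 0) * (#|F| - 0)%N%:R / 'C(n, 2)%:R)) : R.
have M0 : 0 < ('C(n, 2) - a)%N%:R :> R by rewrite ltr0n subn_gt0.
have := @prob_two_times R n finset.set0 F a a 0 0 (c * ('C(n, 2) - a)%N%:R)^-1.
rewrite /= -setI_eq0 finset.set0I eqxx leqnn a0 aN lexx ler01 cards0 !expr0 mulr1 mul1r.
move=> /(_ isT isT isT isT isT isT); rewrite -/c.
rewrite invr_ge0 mulr_ge0 ?expR_ge0// -mulrA mulVf; last first.
  by rewrite mulf_neq0 ?gt_eqF ?expR_gt0.
rewrite lexx => /(_ isT isT).
rewrite /c subr0 mul1r subn0 -expRM_natr mulNr.
by under eq_pr => g _ do rewrite leqn0 cards_eq0 setI_eq0 finset.sub0set andbT.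
Qed.

(** * Edges across a cut, and quantiles *)

Definition cut_edges n (X Y : {set 'I_n}) : {set edge n} :=
  [set e | [exists x in X, exists y in Y, val e == [set x; y]%SET]].

Lemma cut_edgesP n (X Y : {set 'I_n}) (e : edge n) :
  reflect (exists x y, [/\ x \in X, y \in Y & val e = [set x; y]%SET])
    (e \in cut_edges X Y).
Proof.
rewrite inE; apply: (iffP exists_inP) => [[x xX /exists_inP[y yY /eqP exy]]|].
  by exists x, y.
by move=> [x [y [xX yY /eqP exy]]]; exists x => //; apply/exists_inP; exists y.
Qed.

Lemma cut_adj n (G : graph n) (X Y : {set 'I_n}) :
  ~~ [disjoint cut_edges X Y & G] ->
  exists x y, [/\ x \in X, y \in Y & adj G x y].
Proof.
rewrite -setI_eq0 => /set0Pn[e /setIP[/cut_edgesP[x [y [xX yY exy]]] eG]].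
by exists x, y; split=> //; apply/exists_inP; exists e => //; apply/eqP.
Qed.

Lemma card_cut_edges n (X Y : {set 'I_n}) :
  [disjoint X & Y] -> #|cut_edges X Y| = (#|X| * #|Y|)%N.
Proof.
move=> XY; rewrite -cardsX -(card_imset _ val_inj).
rewrite -(@card_in_imset _ _ (fun p : 'I_n * 'I_n => [set p.1; p.2]%SET)).
  congr #|pred_of_set _|; apply/setP => A; apply/imsetP/imsetP.
    move=> [e /cut_edgesP[x [y [xX yY exy]]] ->].
    by exists (x, y) => //; apply/setXP.
  move=> [[x y] /setXP[/= xX yY] ->].
  have xy : #|[set x; y]%SET| == 2.
    by rewrite cards2 (contraTneq _ xX)// => ->; rewrite (disjointFl XY).
  exists (exist (fun e : {set _} => #|e| == 2) _ xy) => //; apply/cut_edgesP.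
  by exists x, y.
move=> [x y] [x' y'] /setXP[/= xX yY] /setXP[/= x'X y'Y] E.
have xE : x = x'.
  have : x \in [set x'; y']%SET by rewrite -E !inE eqxx.
  rewrite !inE => /orP[/eqP//|/eqP xy'].
  by move: xX; rewrite xy' (disjointFl XY).
have yE : y = y'.
  have : y \in [set x'; y']%SET by rewrite -E !inE eqxx orbT.
  rewrite !inE => /orP[/eqP yx'|/eqP//].
  by move: yY; rewrite yx' (disjointFr XY).
by rewrite xE yE.
Qed.

(** Among the vertices with at least [d] vertices weakly below them, take one with the fewest. If
    [d] vertices lay strictly below it, the highest of these would do with fewer. *)
Lemma quantile (R : realType) n (u : 'I_n -> R) d : (0 < d <= n)%N ->
  exists s, (#|[set x | (u x < s)%R]%SET| < d <= #|[set x | (u x <= s)%R]%SET|)%N.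
Proof.
move=> /andP[d0 dn]; have n0 := leq_trans d0 dn.
pose L x := [set y | u y <= u x]%SET.
case: (@arg_maxP _ _ _ (Ordinal n0) xpredT u isT) => m _ um.
have Lm : (d <= #|L m|)%N.
  rewrite (leq_trans dn)// -[leqLHS]card_ord -cardsT subset_leq_card//.
  by apply/fintype.subsetP => y _; rewrite inE; exact: um.
case: (@arg_minnP _ m (fun x => d <= #|L x|)%N (fun x => #|L x|) Lm) => x Lx xmin.
exists (u x); rewrite Lx andbT ltnNge; apply/negP => dx.
have /card_gt0P[y0] := leq_trans d0 dx; rewrite inE => y0x.
case: (@arg_maxP _ _ _ y0 (fun y => u y < u x) u y0x) => y1 y1x ymax.
have E : L y1 = [set y | u y < u x]%SET.
  apply/setP => y; rewrite !inE; apply/idP/idP => [|yx]; last exact: ymax.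
  by move=> /le_lt_trans; apply.
have := xmin y1; rewrite E => /(_ dx); apply/negP; rewrite -ltnNge.
apply: proper_card; apply/fintype.properP; split.
  by apply/fintype.subsetP => y; rewrite !inE => /ltW.
by exists x; rewrite !inE ?lexx ?ltxx.
Qed.

(** * Deterministic criterion for global rigidity *)

Section Rigidity.
Variables (R : realType) (n d : nat) (G : graph n).
Hypotheses (d_gt0 : (0 < d)%N) (d_le : (2 * d <= n)%N).
Hypothesis expansion : forall X Y : {set 'I_n}, [disjoint X & Y] ->
  (d <= #|X|)%N -> (d <= #|Y|)%N -> ~~ [disjoint cut_edges X Y & G].
Hypothesis degree_ge2 : forall x, (2 <= degree G x)%N.
Hypothesis sparse_cut : forall W : {set 'I_n}, (0 < #|W| < 4 * d)%N ->
  (forall x, x \in W -> exists2 y, y \in W & adj G x y) ->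
  (#|W| < #|cut_edges W (~: W) :&: G|)%N.

(* Quantiles of u and v cut the plane into four quadrants; no edge joins
   opposite quadrants. *)
Lemma large_class (u v : 'I_n -> R) :
  (forall x y, adj G x y -> u x = u y \/ v x = v y) ->
  (exists s, #|[set x | u x != s]%SET| < 4 * d)%N \/
  (exists t, #|[set x | v x != t]%SET| < 4 * d)%N.
Proof.
move=> uv; have dn : (0 < 2 * d <= n)%N by rewrite muln_gt0 d_gt0.
(* Fewer than [2 * d] vertices lie strictly below the quantile; if fewer than [2 * d] also lie
   above, its level set misses fewer than [4 * d]. *)
have half (w : 'I_n -> R) : exists s, (2 * d <= #|[set x | (w x <= s :> R)%R]%SET|)%N /\
    ((#|[set x | w x != s]%SET| < 4 * d)%N \/
     (2 * d <= #|~: [set x | (w x <= s)%R]%SET|)%N).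
  have [s /andP[ls sl]] := quantile w dn; exists s; split=> //.
  have [|large] := leqP (2 * d) #|~: [set x | (w x <= s)%R]%SET|; [by right|left].
  have -> : [set x | w x != s]%SET =
      ([set x | (w x < s)%R] :|: ~: [set x | (w x <= s)%R])%SET.
    by apply/setP => x; rewrite !inE -ltNge neq_lt.
  apply: leq_ltn_trans (leq_card_setU _ _) _.
  by move: ls large; lia.
have [s [U [|D]]] := half u; first by left; exists s.
have [t [L [|Rt]]] := half v; first by right; exists t.
set A := [set x | u x <= s]%SET in U D; set B := [set x | v x <= t]%SET in L Rt.
have quad (X Y : {set 'I_n}) :
    (forall x y, x \in X -> y \in Y -> u x != u y /\ v x != v y) ->
    (#|X| < d)%N \/ (#|Y| < d)%N.
  move=> XY; have [|dX] := ltnP #|X| d; [by left|right].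
  rewrite ltnNge; apply/negP => dY.
  have dXY : [disjoint X & Y].
    rewrite -setI_eq0; apply/set0Pn => -[x /setIP[xX xY]].
    by have [/eqP] := XY _ _ xX xY.
  have [x [y [xX yY /uv]]] := cut_adj (expansion dXY dX dY).
  by have [/eqP ? /eqP ?] := XY _ _ xX yY; case.
have q1 : (#|A :&: B| < d)%N \/ (#|~: A :\: B| < d)%N.
  apply: quad => x y; rewrite !inE -!ltNge => /andP[ux vx] /andP[uy vy].
  by rewrite !lt_eqF// ?(le_lt_trans ux)// (le_lt_trans vx).
have q2 : (#|A :\: B| < d)%N \/ (#|~: A :&: B| < d)%N.
  apply: quad => x y; rewrite !inE -!ltNge => /andP[ux vx] /andP[uy vy].
  by rewrite lt_eqF ?gt_eqF// ?(le_lt_trans vy)// (le_lt_trans vx).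
(* Two small quadrants from different opposite pairs fill a half-plane, which would then hold fewer
   than [2 * d] vertices. *)
have := cardsID B A; have := cardsID B (~: A).
have := cardsID A B; have := cardsID A (~: B).
rewrite !finset.setDE !(finset.setIC B) !(finset.setIC (~: B)) -!finset.setDE.
by move: q1 q2 U D L Rt; rewrite !finset.setDE; lia.
Qed.

(** Off [W] the map [u] is constant, so [v] is injective there. An edge leaving [W] changes [u],
    hence keeps [v], so each vertex of [W] has at most one neighbour outside. By the degree
    condition it has one inside, while at most [#|W|] edges leave [W]; for nonempty [W] this
    contradicts [sparse_cut]. *)
Lemma small_complement_empty (u v : 'I_n -> R) s :
  (forall x y, adj G x y -> u x = u y \/ v x = v y) ->
  (forall x y, u x = u y -> v x = v y -> x = y) ->
  (#|[set x | u x != s]%SET| < 4 * d)%N -> forall x, u x = s.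
Proof.
move=> uv inj Wd; set W := [set x | u x != s]%SET in Wd.
suff W0 : W = finset.set0.
  by move=> x; apply/eqP; have := finset.in_set0 x; rewrite -W0 inE => /negbFE.
apply/eqP; rewrite -cards_eq0 eqn0Ngt; apply/negP => W0.
have outside x y y' : x \in W -> y \notin W -> y' \notin W ->
    adj G x y -> adj G x y' -> y = y'.
  rewrite !inE !negbK => xs /eqP ys /eqP ys' /uv xy /uv xy'.
  move: xy xy'; rewrite ys ys' => -[/eqP|vy]; first by rewrite (negbTE xs).
  case=> [/eqP|vy']; first by rewrite (negbTE xs).
  by apply: inj; rewrite ?ys ?ys' -?vy -?vy'.
have inside x : x \in W -> exists2 y, y \in W & adj G x y.
  move=> xW; have /card_gt1P[y [y' []]] := degree_ge2 x; rewrite !inE => xy xy' yy'.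
  have [yW|yW] := boolP (y \in W); first by exists y.
  have [y'W|y'W] := boolP (y' \in W); first by exists y'.
  by rewrite (outside x y y') ?eqxx in yy'.
have := sparse_cut (introT andP (conj W0 Wd)) inside; rewrite ltnNge => /negP; apply.
have [x0 x0W] := card_gt0P W0.
(* [f] sends a cut edge to its end in [W], injectively by [outside]; on cut edges the default [x0]
   is never taken. *)
pose f (e : edge n) := odflt x0 [pick x in val e :&: W].
have fP e : e \in cut_edges W (~: W) :&: G ->
    exists2 y, y \notin W & [/\ f e \in W, adj G (f e) y & val e = [set f e; y]%SET].
  move=> /setIP[/cut_edgesP[x [y [xW yW exy]]] eG]; rewrite inE in yW.
  have -> : f e = x.
    rewrite /f; case: pickP => [z|/(_ x)]; rewrite exy !inE ?eqxx ?(inE _ _)//.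
      move=> /andP[/orP[/eqP//|/eqP->]].
      by rewrite inE in yW; rewrite (negbTE yW).
    by move: xW; rewrite inE => ->.
  by exists y => //; split=> //; apply/exists_inP; exists e => //; apply/eqP.
rewrite -(card_in_imset (f := f)).
  by apply: subset_leq_card; apply/fintype.subsetP => _ /imsetP[e /fP[y _ [fW _ _]] ->].
move=> e e' /fP[y yW [fW fy ey]] /fP[y' yW' [_ fy' ey']] ff.
by apply: val_inj; rewrite ey ey' ff (outside _ y y' fW)// ff.
Qed.

(** Equal lengths are differences equal up to sign, so an edge is constant for [u] or for [v]. A
    constant [u] makes [g] a translate of [f], a constant [v] a translate of [- f]. *)
Lemma expansion_rigid : globally_rigid R G.
Proof.
move=> f g finj ginj fg.
pose u x := f x - g x; pose v x := f x + g x.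
have uv x y : adj G x y -> u x = u y \/ v x = v y.
  move=> /fg/eqP; rewrite eqr_norm2 => /orP[] /eqP; rewrite /u /v; [left|right]; lra.
have inj x y : u x = u y -> v x = v y -> x = y.
  by rewrite /u /v => ? ?; apply: finj; lra.
have [[s Hs]|[t Ht]] := large_class uv.
  have us := small_complement_empty uv inj Hs.
  move=> x y; congr `|_|; have := us x; have := us y; rewrite /u; lra.
have vt : forall x, v x = t.
  apply: (small_complement_empty (v := u)) Ht => x y; last by move=> *; exact: inj.
  by move=> /uv[]; [right|left].
move=> x y; rewrite -[LHS]normrN; congr `|_|.
by have := vt x; have := vt y; rewrite /v; lra.
Qed.

End Rigidity.

(** * Monotonicity and union bounds *)

Lemma pr_ge0 (R : realType) n (P : pred (trajectory n)) : 0 <= pr R P.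
Proof. by apply: sumr_ge0 => g _; exact: path_prob_ge0. Qed.

Lemma le_pr (R : realType) n (P Q : pred (trajectory n)) :
  (forall g, path_prob R g != 0 -> P g -> Q g) -> pr R P <= pr R Q.
Proof.
move=> PQ; rewrite /pr big_mkcond [leRHS]big_mkcond; apply: ler_sum => g _.
have [->|/PQ] := eqVneq (path_prob R g) 0; first by rewrite !if_same.
by case: (P g) => [->//|_]; case: ifP => // _; exact: path_prob_ge0.
Qed.

Lemma pr_or (R : realType) n (P Q : pred (trajectory n)) :
  pr R (fun g => P g || Q g) <= pr R P + pr R Q.
Proof.
rewrite /pr big_mkcond [X in _ <= X + _]big_mkcond [X in _ <= _ + X]big_mkcond.
rewrite -big_split /=.
apply: ler_sum => g _; have := path_prob_ge0 R g.
by case: (P g); case: (Q g) => /=; lra.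
Qed.

Lemma pr_exists (R : realType) n (T : finType) (Q : pred T)
    (P : T -> pred (trajectory n)) :
  pr R (fun g => [exists x, Q x && P x g]) <= \sum_(x | Q x) pr R (P x).
Proof.
rewrite /pr (exchange_big_dep xpredT) //= [leLHS]big_mkcond /=.
apply: ler_sum => g _; case: existsP => [[x /andP[Qx Px]]|_]; last first.
  by apply: sumr_ge0 => *; exact: path_prob_ge0.
rewrite (bigD1 x) ?Qx//= lerDl; apply: sumr_ge0 => *; exact: path_prob_ge0.
Qed.

Lemma pr_not (R : realType) n (P : pred (trajectory n)) :
  pr R (fun g => ~~ P g) = 1 - pr R P.
Proof.
rewrite -(path_prob_sum R (leqnn 'C(n, 2))) [X in _ = X - _](bigID P) /= /pr.
by rewrite addrAC subrr add0r.
Qed.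

(** * Stars, and the second moment of the number of isolated vertices *)

Definition star n (v : 'I_n) : {set edge n} := cut_edges [set v]%SET (~: [set v])%SET.

Lemma card_star n (v : 'I_n) : #|star v| = n.-1.
Proof.
rewrite card_cut_edges ?disjoints1 ?inE ?eqxx// cards1 mul1n cardsCs finset.setCK.
by rewrite cards1 card_ord subn1.
Qed.

Lemma starE n (v : 'I_n) (e : edge n) : (e \in star v) = (v \in val e).
Proof.
apply/idP/idP => [/cut_edgesP[x [y []]]|ve].
  by rewrite inE => /eqP-> _ ->; rewrite !inE eqxx.
apply/cut_edgesP.
have /cards2P[x [y [xy exy]]] := valP e.
move: ve; rewrite exy !inE => /orP[]/eqP vE.
  by exists x, y; rewrite !inE vE eqxx eq_sym.
by exists y, x; rewrite !inE vE eqxx xy finset.setUC.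
Qed.

Lemma card_starU n (u v : 'I_n) : u != v ->
  #|star u :|: star v| = (2 * n - 3)%N.
Proof.
move=> uv; rewrite cardsU !card_star.
have -> : star u :&: star v = cut_edges [set u]%SET [set v]%SET.
  apply/setP => e; rewrite inE !starE; apply/andP/cut_edgesP => [[ue ve]|].
    exists u, v; rewrite !inE !eqxx; split=> //; apply/eqP.
    rewrite eq_sym eqEcard cards2 uv (eqP (valP e)) leqnn andbT.
    by apply/fintype.subsetP => x; rewrite !inE => /orP[]/eqP->.
  by move=> [x [y []]]; rewrite !inE => /eqP-> /eqP-> ->; rewrite !inE !eqxx orbT.
rewrite card_cut_edges ?disjoints1 ?inE// !cards1.
have : (0 < n)%N by case: n u {v uv} => [[]|].
by lia.
Qed.

(* Second moment method: the absences of two stars are negatively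
   correlated. *)
Lemma prob_no_isolated (R : realType) n (m : 'I_('C(n, 2)).+1) :
  (2 < n)%N -> (m + 2 * n <= 'C(n, 2))%N ->
  pr R (fun g : trajectory n => [forall v, ~~ [disjoint star v & g m]]) *
    (n%:R * \prod_(0 <= i < m) (1 - n.-1%:R / ('C(n, 2) - i)%N%:R)) <= 1.
Proof.
move=> n2 mN; set p := \prod_(_ <= _ < _) _; set mu : R := n%:R * p.
pose X (g : trajectory n) : R := \sum_(v : 'I_n) [disjoint star v & g m]%:R.
have prE (P : pred (trajectory n)) : pr R P = \sum_g path_prob R g * (P g)%:R.
  by rewrite /pr big_mkcond; apply: eq_bigr => g _; case: (P g); rewrite ?mulr1 ?mulr0.
have p1 (v : 'I_n) : \sum_g path_prob R g * [disjoint star v & g m]%:R = p.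
  by rewrite -prE prob_disjoint card_star.
have K i : (i < m)%N -> 2 * n%:R <= ('C(n, 2) - i)%N%:R :> R.
  by move=> im; rewrite -natrM ler_nat; lia.
have n0 : 0 < n%:R :> R by rewrite ltr0n; lia.
have p0 : 0 < p.
  rewrite /p big_nat prodr_gt0// => i /andP[_ /K Ki].
  rewrite subr_gt0 ltr_pdivrMr ?mul1r; last by lra.
  apply: lt_le_trans Ki; rewrite -natrM ltr_nat; lia.
have p2 (u v : 'I_n) : u != v ->
    \sum_g path_prob R g * ([disjoint star u & g m]%:R * [disjoint star v & g m]%:R)
    <= p ^+ 2.
  move=> uv; under eq_bigr => g _ do rewrite -natrM mulnb.
  rewrite -prE (@eq_pr _ _ _ (fun g : trajectory n => [disjoint star u :|: star v & g m])).
    rewrite prob_disjoint card_starU// -prodrXl /p !big_nat; apply: ler_prod => i.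
    move=> /andP[_ im]; have Ki := K _ im; set k := ('C(n, 2) - i)%N%:R in Ki *.
    have k0 : 0 < k by lra.
    apply/andP; split.
      rewrite subr_ge0 ler_pdivrMr ?mul1r//; apply: le_trans Ki.
      by rewrite -natrM ler_nat; lia.
    (* The factor [1 - (2 * n - 3) / k] is at most the square of [1 - (n - 1) / k] exactly when [k]
       is at most the square of [n - 1], which is at least ['C(n, 2)]. *)
    have kn : k <= n.-1%:R ^+ 2.
      rewrite -natrX ler_nat (leq_trans (leq_subr _ _))// bin2.
      by case: n n2 {m mN p X prE p1 mu K n0 p0 u v uv im k Ki k0} => //=; nia.
    have -> : (2 * n - 3)%N%:R = 2 * n.-1%:R - 1 :> R.
      by rewrite -natrM -[1]/(1%:R) -natrB; [congr _%:R; lia|lia].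
    rewrite -subr_ge0.
    have -> : (1 - n.-1%:R / k) ^+ 2 - (1 - (2 * n.-1%:R - 1) / k) =
        (n.-1%:R ^+ 2 - k) / k ^+ 2 by field; rewrite gt_eqF.
    by rewrite divr_ge0 ?subr_ge0// exprn_ge0// ltW.
  move=> g _; rewrite -!setI_eq0 finset.setIUl finset.setU_eq0.
  by [].
have EX : \sum_g path_prob R g * X g = mu.
  under eq_bigr do rewrite /X big_distrr /=.
  rewrite exchange_big /=; under eq_bigr do rewrite p1.
  by rewrite sumr_const card_ord -[LHS]mulr_natl.
have EX2 : \sum_g path_prob R g * X g ^+ 2 <= mu + mu ^+ 2.
  have -> : \sum_g path_prob R g * X g ^+ 2 = \sum_(u < n) \sum_(v < n)
      \sum_g path_prob R g *
      ([disjoint star u & g m]%:R * [disjoint star v & g m]%:R).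
    under [RHS]eq_bigr do rewrite exchange_big /=.
    rewrite [RHS]exchange_big /=; apply: eq_bigr => g _.
    rewrite expr2 /X big_distrl /= big_distrr /=; apply: eq_bigr => u _.
    by rewrite !big_distrr.
  apply: (@le_trans _ _ (\sum_(u < n) (p + n%:R * p ^+ 2))).
    apply: ler_sum => u _; rewrite (bigD1 u)//= lerD//.
      under eq_bigr => g _ do rewrite -natrM mulnb andbb.
      by rewrite p1.
    apply: (@le_trans _ _ (\sum_(v < n) p ^+ 2)); last first.
      by rewrite sumr_const card_ord -[leLHS]mulr_natl.
    rewrite [leLHS]big_mkcond ler_sum// => v _; case: ifP => [vu|_].
      by apply: p2; rewrite eq_sym.
    by rewrite exprn_ge0// ltW.
  by rewrite sumr_const card_ord -[leLHS]mulr_natl /mu; lra.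
have mu0 : 0 < mu by rewrite mulr_gt0.
(* Chebyshev: the variance is at most [mu], and on the event [X = 0] the squared deviation is
   [mu ^+ 2]. *)
rewrite -(ler_pM2r mu0) mul1r -mulrA -expr2.
apply: (@le_trans _ _ (\sum_g path_prob R g * (X g - mu) ^+ 2)).
  rewrite prE big_distrl /= ler_sum// => g _; rewrite -mulrA.
  apply: ler_wpM2l; first exact: path_prob_ge0.
  case: forallP => [gX|_]; last by rewrite mul0r sqr_ge0.
  rewrite mul1r (_ : X g = 0) ?sub0r ?sqrrN//.
  by rewrite /X big1// => v _; rewrite (negbTE (gX v)).
have -> : \sum_g path_prob R g * (X g - mu) ^+ 2 =
    \sum_g path_prob R g * X g ^+ 2 - 2 * mu * \sum_g path_prob R g * X g +
    mu ^+ 2 * \sum_(g : trajectory n) path_prob R g.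
  rewrite !big_distrr /= -sumrB -big_split /=; apply: eq_bigr => g _; ring.
rewrite EX path_prob_sum//; move: EX2; lra.
Qed.

(** * Minimum degree and missing edges *)

Lemma min_degree_geP n (G : graph n) k : (k <= n)%N ->
  reflect (forall x, (k <= degree G x)%N) (k <= min_degree G)%N.
Proof.
move=> kn; apply: (iffP idP) => [kG x|kG].
  move: kG; rewrite /min_degree.
  have : x \in index_enum 'I_n by rewrite mem_index_enum.
  elim: (index_enum _) => // y s IH; rewrite inE big_cons leq_min.
  by case/orP => [/eqP-> /andP[]|/IH + /andP[_]].
by rewrite /min_degree; elim/big_ind: _ => // p q; rewrite leq_min => -> ->.
Qed.

Lemma sub_adj n (G H : graph n) x y : G \subset H -> adj G x y -> adj H x y.
Proof.
move=> /fintype.subsetP GH /exists_inP[e eG exy].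
by apply/exists_inP; exists e => //; exact: GH.
Qed.

Lemma sub_degree n (G H : graph n) x :
  G \subset H -> (degree G x <= degree H x)%N.
Proof.
move=> GH; apply: subset_leq_card; apply/fintype.subsetP => y.
by rewrite !inE; exact: sub_adj.
Qed.

Lemma sub_min_degree n (G H : graph n) k : (k <= n)%N ->
  G \subset H -> (k <= min_degree G)%N -> (k <= min_degree H)%N.
Proof.
move=> kn GH /(min_degree_geP _ kn) kG; apply/(min_degree_geP _ kn) => x.
exact: leq_trans (kG x) (sub_degree _ GH).
Qed.

Lemma isolated_min_degree n (G : graph n) v :
  [disjoint star v & G] -> (min_degree G < 2)%N \/ (n < 2)%N.
Proof.
move=> vG; have [|n2] := ltnP n 2; [by right|left].
rewrite ltnNge; apply/negP => /(min_degree_geP _ n2)/(_ v).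
rewrite /degree => /ltnW/card_gt0P[y]; rewrite inE => /exists_inP[e eG /eqP ev].
have : e \in star v by rewrite starE ev !inE eqxx.
by move=> /(disjointFr vG); rewrite eG.
Qed.

(** Take for [u] the only neighbour, or [v] itself if there is none. Low degree thus becomes the
    absence of a fixed edge set, ready for a union bound over pairs [(v, u)]. *)
Lemma degree_lt2 n (G : graph n) v : (degree G v < 2)%N ->
  exists u, [disjoint cut_edges [set v]%SET (~: [set v; u])%SET & G].
Proof.
move=> vG.
have [u uG] : exists u, forall y, adj G v y -> y = u.
  move: vG; rewrite /degree => /card_le1P vG.
  have [/existsP[u vu]|/existsPn nv] := boolP [exists u, adj G v u].
    exists u => y vy; have := vG u; rewrite inE => /(_ vu y).
    by rewrite !inE vy => /esym/eqP.
  by exists v => y vy; move: (nv y); rewrite vy.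
exists u; rewrite -setI_eq0; apply/set0Pn => -[e /setIP[/cut_edgesP[x [y []]]]].
rewrite !inE => /eqP-> yu exy eG.
have /uG yE : adj G v y by apply/exists_inP; exists e => //; apply/eqP.
by rewrite yE eqxx orbT in yu.
Qed.

(** * The bad events at the two bracketing times *)

Definition choice_edges n (W : {set 'I_n}) (phi : {ffun 'I_n -> 'I_n}) :
    {set edge n} :=
  [set e | [exists x in W, val e == [set x; phi x]%SET]].

Section Events.
Variables (n d : nat) (a b : 'I_('C(n, 2)).+1).

Definition no_isolated (g : trajectory n) : bool :=
  [forall v, ~~ [disjoint star v & g a]].

Definition has_low_degree (g : trajectory n) : bool :=
  [exists p : 'I_n * 'I_n,
    [disjoint cut_edges [set p.1]%SET (~: [set p.1; p.2])%SET & g b]].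

Definition has_hole (g : trajectory n) : bool :=
  [exists p : {set 'I_n} * {set 'I_n},
    [&& [disjoint p.1 & p.2], (d <= #|p.1|)%N & (d <= #|p.2|)%N] &&
    [disjoint cut_edges p.1 p.2 & g a]].

(* p.2 chooses a neighbour inside p.1 for each vertex of p.1; it is the
   identity outside, so that there are #|p.1| ^ #|p.1| choices. *)
Definition admissible (p : {set 'I_n} * {ffun 'I_n -> 'I_n}) : bool :=
  [&& (0 < #|p.1| < 4 * d)%N,
      p.2 \in family (fun x => if x \in p.1 then p.1 else [set x]%SET) &
      [forall x in p.1, p.2 x != x]].

Definition has_sparse_cut (g : trajectory n) : bool :=
  [exists p, admissible p &&
    ((#|cut_edges p.1 (~: p.1) :&: g a| <= #|p.1|)%N &&
     (choice_edges p.1 p.2 \subset g b))].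

(** The isolated vertex at time [a] and the degrees at time [b] give [a <= tau <= b]. The rest is
    monotonicity: expansion passes up from [g a], a sparse cut passes down to [g a], and the
    neighbours chosen in [g tau] survive in [g b]. *)
Lemma hitting_time_rigid (R : realType) (g : trajectory n) :
  path_prob R g != 0 -> (0 < d)%N -> (2 * d <= n)%N ->
  ~~ no_isolated g -> ~~ has_low_degree g -> ~~ has_hole g ->
  ~~ has_sparse_cut g -> globally_rigid R (g (hitting_time 2 g)).
Proof.
move=> /path_prob_mono gm d0 dn /forallPn[v /negPn isol] low hole sparse.
have n2 : (2 <= n)%N by lia.
have min_b : (2 <= min_degree (g b))%N.
  apply/(min_degree_geP _ n2) => x; rewrite leqNgt; apply/negP => /degree_lt2[u xu].
  by case/negP: low; apply/existsP; exists (x, u).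
(* The [arg min] needs its condition at the default value [ord_max]. *)
have min_max : (2 <= min_degree (g ord_max))%N.
  by apply: sub_min_degree min_b => //; apply: gm; rewrite -ltnS.
rewrite /hitting_time; case: arg_minnP => // tau min_tau tau_min.
have tb : (tau <= b)%N by exact: tau_min.
have at_ : (a <= tau)%N.
  rewrite leqNgt; apply/negP => /ltnW/gm ta.
  have [|] := isolated_min_degree isol; last by rewrite ltnNge n2.
  by rewrite ltnNge (sub_min_degree n2 ta min_tau).
have ga := gm _ _ at_; have gb := gm _ _ tb.
apply: (@expansion_rigid R n d) => //.
- move=> X Y XY dX dY; apply/negP => XYg; case/negP: hole; apply/existsP.
  exists (X, Y); rewrite /= XY dX dY /=.
  by rewrite disjoint_sym (disjointWl ga)// disjoint_sym.
- by apply/min_degree_geP.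
- move=> W Wd inside; rewrite ltnNge; apply/negP => cutW.
  case/negP: sparse; apply/existsP.
  pose f x := if x \in W then odflt x [pick y in W | adj (g tau) x y] else x.
  have fP x : x \in W -> (f x \in W) && adj (g tau) x (f x).
    move=> xW; have [y yW xy] := inside x xW; rewrite /f xW; case: pickP => [z //|/(_ y)].
    by rewrite yW xy.
  exists (W, finfun f); rewrite /admissible /= Wd /=; apply/andP; split; last first.
    apply/andP; split.
      apply: leq_trans cutW; apply: subset_leq_card.
      by rewrite finset.setIS.
    apply/fintype.subsetP => e; rewrite inE => /exists_inP[x xW]; rewrite ffunE => exf.
    have /andP[_ /exists_inP[e' e'g /eqP e'f]] := fP x xW.
    have -> : e = e' by apply: val_inj; rewrite e'f; apply/eqP.
    exact: (fintype.subsetP gb).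
  apply/andP; split.
    apply/familyP => x; rewrite ffunE; have [xW|xW] := boolP (x \in W).
      by have /andP[] := fP x xW.
    by rewrite /f (negbTE xW) inE.
  apply/forall_inP => x xW; rewrite ffunE.
  have /andP[_ /exists_inP[e _ /eqP ef]] := fP x xW.
  apply: contraTneq (valP e) => fx.
  by rewrite ef fx finset.setUid cards1.
Qed.

Lemma prob_low_degree (R : realType) : (0 < b)%N -> (b < 'C(n, 2))%N ->
  pr R has_low_degree <= n%:R ^+ 2 * expR (- ((n - 2)%N%:R / 'C(n, 2)%:R * b%:R)).
Proof.
move=> b0 bN.
apply: le_trans (_ : pr R (fun g => [exists p : 'I_n * 'I_n, true &&
    [disjoint cut_edges [set p.1]%SET (~: [set p.1; p.2])%SET & g b]]) <= _) _ => //.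
apply: le_trans (pr_exists _ _ _) _.
apply: (@le_trans _ _ (\sum_(p : 'I_n * 'I_n)
    expR (- ((n - 2)%N%:R / 'C(n, 2)%:R * b%:R) : R))).
  apply: ler_sum => -[v u] _ /=; apply: le_trans (prob_disjoint_le _ _ b0 bN) _.
  rewrite ler_expR lerN2 ler_wpM2r// ler_wpM2r ?invr_ge0// ler_nat.
  rewrite card_cut_edges ?disjoints1 ?inE ?eqxx// cards1 mul1n.
  rewrite cardsCs finset.setCK card_ord leq_sub2l// cards2.
  by case: eqP.
by rewrite sumr_const card_prod card_ord -[leLHS]mulr_natl natrM expr2.
Qed.

Lemma prob_hole (R : realType) : (0 < a)%N -> (a < 'C(n, 2))%N ->
  pr R has_hole <= 4 ^+ n * expR (- ((d * d)%N%:R / 'C(n, 2)%:R * a%:R)).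
Proof.
move=> a0 aN; apply: le_trans (pr_exists _ _ _) _.
apply: (@le_trans _ _ (\sum_(p : {set 'I_n} * {set 'I_n})
    expR (- ((d * d)%N%:R / 'C(n, 2)%:R * a%:R) : R))).
  rewrite big_mkcond ler_sum// => -[X Y] _ /=; case: ifP => [/and3P[XY dX dY]|_].
    apply: le_trans (prob_disjoint_le _ _ a0 aN) _.
    rewrite ler_expR lerN2 ler_wpM2r// ler_wpM2r ?invr_ge0// ler_nat.
    by rewrite card_cut_edges// leq_mul.
  exact: expR_ge0.
rewrite sumr_const card_prod -[leLHS]mulr_natl -cardsT -powersetT card_powerset.
by rewrite cardsT card_ord -expnMn natrX.
Qed.

(** The chosen edges cover [W] and each covers two vertices; two vertices may choose each other. *)
Lemma card_choice_edges (W : {set 'I_n}) (phi : {ffun 'I_n -> 'I_n}) :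
  (forall x, x \in W -> phi x != x) -> (#|W| <= #|choice_edges W phi| * 2)%N.
Proof.
move=> phiW; pose U := (\bigcup_(e in choice_edges W phi) val e)%SET.
apply: (@leq_trans #|U|).
  apply: subset_leq_card; apply/fintype.subsetP => x xW.
  have xy : #|[set x; phi x]%SET| == 2 by rewrite cards2 [x == _]eq_sym phiW.
  apply/finset.bigcupP; exists (exist (fun e : {set _} => #|e| == 2) _ xy).
    by rewrite inE; apply/exists_inP; exists x.
  by rewrite /= !inE eqxx.
rewrite -sum_nat_const /U; elim/big_rec2: _ => [|e m X _ Xm].
  by rewrite cards0.
by rewrite (leq_trans (leq_card_setU _ _))// (eqP (valP e)) leq_add2l.
Qed.

(** [prob_two_times] is applied with [F] the boundary of [W], [A] the chosen edges, [w = #|W|] and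
    [z = 1 / 8]. Dividing by [z ^+ w] gives the [8]; [#|F| - w = w * (n - w - 1)] with [w < 4 * d]
    gives the exponential; [w <= 2 * #|A|] turns [kappa * b <= s ^+ 2] into the power of [s]. *)
Lemma prob_sparse_cut_le (R : realType) (s kappa : R) p :
  (a <= b)%N -> (0 < b)%N -> (b < 'C(n, 2))%N -> (4 * d <= n)%N ->
  0 <= s <= 1 -> 0 <= kappa -> kappa * b%:R <= s ^+ 2 ->
  1 <= kappa * expR (-1) * ('C(n, 2) - b)%N%:R -> admissible p ->
  pr R (fun g => (#|cut_edges p.1 (~: p.1) :&: g a| <= #|p.1|)%N &&
     (choice_edges p.1 p.2 \subset g b)) <=
  (8 * s * expR (- (7 / 8 * (n - 4 * d)%N%:R / 'C(n, 2)%:R * a%:R))) ^+ #|p.1|.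
Proof.
have z01 : 0 <= (1 / 8 : R) <= 1 by apply/andP; split; lra.
have z78 : 1 - 1 / 8 = 7 / 8 :> R by lra.
have [z0 z1] : (0 <= 7 / 8 :> R) /\ (7 / 8 <= 1 :> R) by split; lra.
have assoc (x y z t u : R) : x * y * z * t * u = x * (y * u) * z * t by ring.
have z8 : 1 / 8 * 8 = 1 :> R by lra.
have z8' : 0 < 1 / 8 :> R by lra.
move=> ab b0 bN dn /andP[s0 s1] k0 ks kN /and3P[/andP[W0 Wd] /familyP phiF phix].
case: p W0 Wd phiF phix => W phi /= W0 Wd phiF /forall_inP phix.
set F := cut_edges W (~: W); set A := choice_edges W phi; set w := #|W| in W0 Wd *.
have N0 : 0 < 'C(n, 2)%:R :> R by rewrite ltr0n (leq_ltn_trans _ bN).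
have cF : #|F| = (w * (n - w))%N.
  rewrite card_cut_edges -?setI_eq0 ?finset.setICr ?eqxx//.
  by rewrite [#|~: W|]cardsCs finset.setCK card_ord.
have wF : (w <= #|F|)%N by rewrite cF leq_pmulr// subn_gt0 (leq_trans Wd).
have AF : [disjoint A & F].
  rewrite -setI_eq0; apply/set0Pn => -[e /setIP[]]; rewrite inE.
  move=> /exists_inP[x xW /eqP ex] /cut_edgesP[y [z [yW]]]; rewrite inE => zW eyz.
  have : z \in [set x; phi x]%SET by rewrite -ex eyz !inE eqxx orbT.
  rewrite !inE => /orP[]/eqP zE; first by rewrite zE xW in zW.
  by move: (phiF x); rewrite xW -zE (negbTE zW).
have := @prob_two_times R n A F a b w (1 / 8) kappa ab b0 bN z01 wF AF k0.
set c := expR _ => /= main.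
have F1 : (1 - 1 / 8 : R) * (#|F| - w)%N%:R / 'C(n, 2)%:R <= 1.
  rewrite z78 ler_pdivrMr// ler_pM//.
  rewrite ler_nat (leq_trans (leq_subr _ _))// -card_edge.
  exact: max_card.
have kc : 1 <= kappa * c * ('C(n, 2) - b)%N%:R.
  apply: le_trans kN _; rewrite ler_wpM2r// ler_wpM2l// ler_expR lerN2.
  exact: F1.
have {kc} := main kc; move=> {}main.
have cE : c ^+ a <= expR (- (7 / 8 * (n - 4 * d)%N%:R / 'C(n, 2)%:R * a%:R)) ^+ w.
  rewrite -!expRM_natr ler_expR !mulNr lerN2 z78 assoc ler_wpM2r//.
  rewrite ler_wpM2r ?invr_ge0// ler_wpM2l// -natrM ler_nat cF.
  rewrite mulnC -[X in (_ <= _ - X)%N]muln1 -mulnBr leq_mul2l -subnDA.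
  by rewrite leq_sub2l ?orbT// addn1.
have sA : (kappa * b%:R) ^+ #|A| <= s ^+ w.
  apply: (@le_trans _ _ ((s ^+ 2) ^+ #|A|)).
    by rewrite lerXn2r ?nnegrE ?mulr_ge0// exprn_ge0.
  rewrite -exprM ler_wiXn2l// mulnC; exact: card_choice_edges.
rewrite !exprMn -(ler_pM2l (_ : 0 < (1 / 8) ^+ w)); last by rewrite exprn_gt0.
apply: le_trans main _.
rewrite -!mulrA [leRHS]mulrA -[_ ^+ w * 8 ^+ w]exprMn z8 expr1n mul1r mulrC; apply: ler_pM => //.
  by rewrite exprn_ge0// mulr_ge0.
  by rewrite exprn_ge0// expR_ge0.
by move: cE; rewrite -!mulrA.
Qed.

End Events.

(** * Summation over vertex sets and choices of neighbours *)

Lemma sum_card_sets (R : realType) n (F : nat -> R) :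
  \sum_(W : {set 'I_n}) F #|W| = \sum_(k < n.+1) 'C(n, k)%:R * F k.
Proof.
have Wn (W : {set 'I_n}) : (#|W| < n.+1)%N.
  by rewrite ltnS -[leqRHS]card_ord max_card.
rewrite (partition_big (fun W : {set 'I_n} => Ordinal (Wn W)) xpredT)//=.
apply: eq_bigr => k _; rewrite (eq_bigr (fun=> F k)); last by move=> W /eqP <-.
have -> : 'C(n, k) = #|[set W : {set 'I_n} | #|W| == k]|%SET.
  by rewrite card_draws card_ord.
rewrite sumr_const -[LHS]mulr_natl.
by congr (_%:R * _); apply: eq_card => W; rewrite unfold_in inE.
Qed.

(** The binomial is at most [n ^ k] over [k] factorial, and [k ^ k] over [k] factorial is a term of
    the series of [expR k]. *)
Lemma bin_pow_le (R : realType) n k :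
  'C(n, k)%:R * k%:R ^+ k <= (n%:R * expR 1) ^+ k :> R.
Proof.
case: k => [|k]; first by rewrite bin0 !expr0 mulr1.
have f0 : 0 < (k.+1)`!%:R :> R by rewrite ltr0n fact_gt0.
have E : k.+1%:R ^+ k.+1 <= (k.+1)`!%:R * expR k.+1%:R :> R.
  rewrite mulrC -ler_pdivrMr//.
  by apply: le_trans (expR_ge1Dxn k (ler0n R k.+1)); rewrite lerDr.
apply: le_trans (ler_wpM2l (ler0n R _) E) _.
rewrite mulrA -natrM bin_ffact exprMn -[X in expR X]mul1r expRM_natr.
rewrite ler_wpM2r ?exprn_ge0 ?expR_ge0// -natrX ler_nat.
rewrite ffact_prod -[X in (_ <= _ ^ X)%N](card_ord k.+1) -prod_nat_const.
by apply: leq_prod => i _; exact: leq_subr.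
Qed.

Lemma geometric_le (R : realType) (y : R) m : 0 <= y -> 2 * y <= 1 ->
  \sum_(k < m.+1) (0 < k)%N%:R * y ^+ k <= 2 * y.
Proof.
(* Carrying the tail bound [2 * y ^+ m.+1] makes the induction close. *)
move=> y0 y1; suff : \sum_(k < m.+1) (0 < k)%N%:R * y ^+ k + 2 * y ^+ m.+1 <= 2 * y.
  by have := exprn_ge0 m.+1 y0; lra.
elim: m => [|m IH]; first by rewrite big_ord_recl big_ord0 mul0r !add0r expr1.
rewrite big_ord_recr /= mul1r; apply: le_trans IH; rewrite -addrA lerD2l.
rewrite [y ^+ m.+2]exprS; have := ler_wpM2r (exprn_ge0 m.+1 y0) y1; lra.
Qed.

(** A set of size [k] admits at most [k ^ k] choices, so by [bin_pow_le] the union bound is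
    dominated by the sum of [y ^+ k] over [k > 0]. *)
Lemma prob_sparse_cut (R : realType) n d (a b : 'I_('C(n, 2)).+1) (s kappa : R) :
  let y := n%:R * expR 1 *
    (8 * s * expR (- (7 / 8 * (n - 4 * d)%N%:R / 'C(n, 2)%:R * a%:R))) in
  (a <= b)%N -> (0 < b)%N -> (b < 'C(n, 2))%N -> (4 * d <= n)%N ->
  0 <= s <= 1 -> 0 <= kappa -> kappa * b%:R <= s ^+ 2 ->
  1 <= kappa * expR (-1) * ('C(n, 2) - b)%N%:R -> 2 * y <= 1 ->
  pr R (has_sparse_cut d a b) <= 2 * y.
Proof.
move=> y ab b0 bN dn s01 k0 ks kN y1.
set x := 8 * s * _ in y y1 *.
have x0 : 0 <= x by case/andP: s01 => s0 _; rewrite !mulr_ge0// expR_ge0.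
have y0 : 0 <= y by rewrite mulr_ge0// mulr_ge0 ?expR_ge0.
apply: le_trans (pr_exists _ _ _) _.
apply: (@le_trans _ _ (\sum_(p | admissible d p) x ^+ #|p.1|)).
  by apply: ler_sum => p adm; exact: (prob_sparse_cut_le ab b0 bN dn s01 k0 ks kN adm).
apply: (@le_trans _ _ (\sum_(W : {set 'I_n}) (0 < #|W|)%N%:R *
    (#|W|%:R ^+ #|W| * x ^+ #|W|))); last first.
  rewrite (sum_card_sets _ (fun k => (0 < k)%N%:R * (k%:R ^+ k * x ^+ k))).
  apply: le_trans (geometric_le n y0 y1).
  apply: ler_sum => k _; rewrite mulrCA ler_wpM2l// mulrA /y [leRHS]exprMn.
  by rewrite ler_wpM2r ?exprn_ge0// bin_pow_le.
rewrite (_ : \sum_(p | admissible d p) x ^+ #|p.1| =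
    \sum_(W : {set 'I_n}) \sum_(phi | admissible d (W, phi)) x ^+ #|W|); last first.
  by rewrite pair_big_dep; apply: eq_bigl => -[].
apply: ler_sum => W _; case: (posnP #|W|) => W0.
  by rewrite mul0r big_pred0// => phi; rewrite /admissible /= W0.
rewrite mul1r sumr_const -[leLHS]mulr_natl ler_wpM2r ?exprn_ge0//.
rewrite -natrX ler_nat.
pose F x := if x \in W then W else [set x]%SET.
apply: (@leq_trans #|family F|).
  apply: subset_leq_card; apply/fintype.subsetP => phi.
  by rewrite unfold_in => /and3P[].
rewrite card_family foldrE big_map big_enum /= (bigID (mem W)) /=.
rewrite [X in (_ * X)%N]big1 => [|z zW]; last by rewrite /F (negbTE zW) cards1.
rewrite muln1 -prod_nat_const; apply: leq_prod => z zW.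
by rewrite /F zW.
Qed.

(** * Real estimates for the chosen times *)

(** The inverse of [1 - q / K] is [1 + q / (K - q)], so [1 + t <= expR t] applies. *)
Lemma expRN_le (R : realType) (q K : R) : 0 <= q -> q < K ->
  expR (- (q / (K - q))) <= 1 - q / K.
Proof.
move=> q0 qK; have Kq : 0 < K - q by rewrite subr_gt0.
have K0 : 0 < K by exact: le_lt_trans qK.
rewrite expRN invf_ple ?posrE ?expR_gt0//; last first.
  by rewrite subr_gt0 ltr_pdivrMr ?mul1r.
apply: le_trans (expR_ge1Dx _); rewrite le_eqVlt; apply/orP; left; apply/eqP.
by field; rewrite !gt_eqF// subrr.
Qed.

Lemma prod_lower (R : realType) (N m : nat) (q t : R) :
  0 <= q -> q < N%:R - m%:R -> q / (N%:R - m%:R - q) <= t ->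
  expR (- (t * m%:R)) <= \prod_(0 <= i < m) (1 - q / (N - i)%N%:R).
Proof.
move=> q0 qN qt.
have mN : (m <= N)%N by rewrite -(ler_nat R) -subr_ge0 ltW// (le_lt_trans q0).
rewrite -mulNr expRM_natr -[X in _ ^+ X]subn0 -prodr_const_nat.
rewrite !big_nat; apply: ler_prod => i /andP[_ im]; rewrite expR_ge0 /=.
have iN : (i <= N)%N by rewrite (leq_trans (ltnW im)).
have im' : i%:R <= m%:R :> R by rewrite ler_nat ltnW.
rewrite natrB//; set k := N%:R - i%:R.
have km : N%:R - m%:R <= k by rewrite lerD2l lerN2.
have qk := lt_le_trans qN km.
apply: le_trans (expRN_le q0 qk); rewrite ler_expR lerN2; apply: le_trans qt.
rewrite ler_wpM2l// lef_pV2 ?posrE ?subr_gt0//.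
by rewrite lerD2r.
Qed.

Lemma bin2R (R : realType) n : 'C(n, 2)%:R = n%:R * (n%:R - 1) / 2 :> R.
Proof.
case: n => [|n]; first by rewrite bin0n !mul0r.
have /(congr1 (fun k => k%:R : R)) := bin_ffact n.+1 2.
rewrite ffactnS ffactn1 /= !natrM => E.
rewrite -[n.+1%:R - 1]/(n.+1%:R - 1%:R) -natrB// subn1 /= -E.
by field.
Qed.

Section Estimates.
Variables (R : realType) (n : nat).
Let x : R := n%:R.
Let L : R := ln x.
Hypothesis L_large : 400 * 400 <= L.

Lemma ln_large_gt0 : 0 < x.
Proof.
rewrite ltNge; apply/negP => /ln0; move: L_large; rewrite /L => + E.
by rewrite E; lra.
Qed.

Lemma expR_ln_large : expR L = x. Proof. by rewrite lnK// posrE ln_large_gt0. Qed.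

(** [x = expR L] exceeds [L ^+ 2 / 2], and one factor [L] is at least [400 * 400]. *)
Lemma ln_le_natr : 200 * 400 * L <= x.
Proof.
rewrite -expR_ln_large; have L0 : 0 <= L by move: L_large; lra.
apply: le_trans (expR_ge1Dxn 1 L0); rewrite expr2.
have -> : 2`!%:R = 2 :> R by [].
by move: L_large => LL; nra.
Qed.
End Estimates.

(* x, L, N stand for n, ln n, 'C(n, 2), and alpha, beta for the times that
   bracket the hitting time, which is about x * L / 2. *)
Definition regime (R : realType) (x L alpha beta N : R) : Prop :=
  [/\ 400 * 400 <= L /\ 200 * 400 * L <= x, N = x * (x - 1) / 2,
      7 / 16 * (x * L) - 1 <= alpha <= 7 / 16 * (x * L) &
      2 * (x * L) <= beta <= 2 * (x * L) + 1].

Section RealEstimates.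
Variables (R : realType) (x L alpha beta N : R).
Hypothesis reg : regime x L alpha beta N.

Lemma regime_basic : [/\ 0 < L, 400 * 400 <= x, 0 < N & 200 * 400 * (x * L) <= x * x].
Proof.
have [[L_ge xL] NE /andP[alpha_ge alpha_le] /andP[beta_ge beta_le]] := reg.
have L0 : 0 < L by lra.
have x1 : 400 * 400 <= x by lra.
split=> //; first by rewrite NE; nra.
by rewrite mulrCA ler_wpM2l//; lra.
Qed.

Lemma regime_bin_ge : 200 * 400 * (x * L) <= 4 * N /\ x * x <= 4 * N.
Proof.
have [[L_ge xL] NE /andP[alpha_ge alpha_le] /andP[beta_ge beta_le]] := reg.
by have [L0 x1 N0 xxL] := regime_basic; rewrite NE; split; nra. Qed.

Lemma alpha_lt_N : alpha + 2 * x <= N.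
Proof.
have [[L_ge xL] NE /andP[alpha_ge alpha_le] /andP[beta_ge beta_le]] := reg.
by have [L0 x1 N0 xxL] := regime_basic; have [NL Nx] := regime_bin_ge; nra.
Qed.

Lemma beta_lt_N : 2 * beta <= N /\ 1 <= beta.
Proof.
have [[L_ge xL] NE /andP[alpha_ge alpha_le] /andP[beta_ge beta_le]] := reg.
by have [L0 x1 N0 xxL] := regime_basic; have [NL Nx] := regime_bin_ge; split; nra.
Qed.

Lemma alpha_bounds : 1 <= alpha /\ alpha <= beta.
Proof.
have [[L_ge xL] NE /andP[alpha_ge alpha_le] /andP[beta_ge beta_le]] := reg.
by have [L0 x1 N0 xxL] := regime_basic; split; nra. Qed.

(** The quotient is close to [2 / x]; [32 / 15] leaves room for lower-order terms. As
    [32 / 15 * (7 / 16) = 14 / 15], a share [L / 15] of [L] remains. *)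
Lemma isolated_estimate : (x - 1) / (N - alpha - (x - 1)) <= 32 / 15 / x /\
  L / 20 <= L - 32 / 15 / x * alpha.
Proof.
have [[L_ge xL] NE /andP[alpha_ge alpha_le] /andP[beta_ge beta_le]] := reg.
have [L0 x1 N0 xxL] := regime_basic; have [NL Nx] := regime_bin_ge.
have x0 : 0 < x by lra.
have aN := alpha_lt_N.
split.
  rewrite ler_pdivrMr; last by lra.
  rewrite mulrAC ler_pdivlMr//.
  by move: NE alpha_le; nra.
have -> : 32 / 15 / x * alpha = 32 / 15 * (alpha / x) by field; rewrite gt_eqF.
have : alpha / x <= 7 / 16 * L by rewrite ler_pdivrMr//; lra.
by lra.
Qed.

(** The [2 * L] counts pairs of vertices. The subtracted term is close to [4 * L], of which [3 * L]
    suffices. *)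
Lemma low_degree_estimate : 2 * L - (x - 2) / N * beta <= - L.
Proof.
have [[L_ge xL] NE /andP[alpha_ge alpha_le] /andP[beta_ge beta_le]] := reg.
have [L0 x1 N0 xxL] := regime_basic.
suff : 3 * L <= (x - 2) / N * beta by lra.
rewrite mulrAC ler_pdivlMr// NE.
have : (x - 2) * (2 * (x * L)) <= (x - 2) * beta by rewrite ler_wpM2l//; lra.
have xl0 : 0 < x * L by rewrite mulr_gt0//; lra.
have : 0 <= (x - 5) * (x * L) by rewrite mulr_ge0//; lra.
by lra.
Qed.

(** The [2 * x] pays for the pairs of sets, since [4 <= expR 2]. The subtracted term is at least
    [alpha / (128 * 64)], of order [x * L], and wins because [L] is large. *)
Lemma hole_estimate delta : x <= 128 * delta ->
  2 * x - delta * delta / N * alpha <= - L.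
Proof.
have [[L_ge xL] NE /andP[alpha_ge alpha_le] /andP[beta_ge beta_le]] := reg.
move=> xd; have [L0 x1 N0 xxL] := regime_basic.
have x0 : 0 < x by lra.
have xx : x * x <= (128 * 128) * (delta * delta).
  have -> : (128 * 128) * (delta * delta) = (128 * delta) * (128 * delta) by ring.
  by rewrite ler_pM//; lra.
have Nxx : 2 * N <= x * x by rewrite NE; lra.
have D : 1 <= (128 * 64) * (delta * delta / N).
  by rewrite mulrA ler_pdivlMr//; lra.
have a0 : 0 <= alpha by have [] := alpha_bounds; lra.
have : alpha <= (128 * 64) * (delta * delta / N) * alpha by rewrite ler_peMl.
have : 400 * 400 * x <= x * L by rewrite mulrC ler_wpM2l//; lra.
by lra.
Qed.

(** Here [7 / 8] is [1 - z] for [z = 1 / 8]. Up to lower-order terms the right side is at least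
    [7 / 8 * (15 / 16) * (7 / 8) * L], and [735 / 1024] exceeds [5 / 8]. *)
Lemma sparse_estimate delta : 16 * delta <= x ->
  5 / 8 * L <= 7 / 8 * (x - delta) / N * alpha.
Proof.
have [[L_ge xL] NE /andP[alpha_ge alpha_le] /andP[beta_ge beta_le]] := reg.
move=> dx; have [L0 x1 N0 xxL] := regime_basic.
rewrite [leRHS]mulrAC ler_pdivlMr// NE.
have x0 : 0 < x by lra.
have : (15 / 16 * x) * (7 / 16 * (x * L) - 1) <= (x - delta) * alpha.
  by apply: ler_pM => //; nra.
have : 0 <= x * (x * L) - 400 * x by nra.
by nra.
Qed.

End RealEstimates.

Lemma expR1_le4 (R : realType) : expR 1 <= 4 :> R.
Proof.
have h : 1 / 2 <= expR (- (1 / 2)) :> R.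
  by apply: le_trans (expR_ge1Dx _); lra.
have e : 1 / 4 <= expR (- 1) :> R.
  have -> : - 1 = - (1 / 2) + - (1 / 2) :> R by lra.
  rewrite expRD; apply: le_trans (ler_pM _ _ h h); lra.
have := ler_wpM2r (expR_ge0 (1 : R)) e.
by rewrite -expRD addNr expR0; lra.
Qed.

(** The right side is [expR (- (9 / 10 * L))], so what is needed is [96 * L <= expR (L / 10)], which
    the quadratic term of the series gives. *)
Lemma ln_over_n_le (R : realType) (L : R) : 400 * 400 <= L ->
  96 * L * expR (- L) <= expR (- (9 / 20 * L)) ^+ 2.
Proof.
move=> LL; have -> : - L = - (9 / 20 * L) *+ 2 + - (L / 10) by rewrite mulr2n; lra.
rewrite expRD mulr2n expRD -expr2 mulrCA ler_piMr ?exprn_ge0 ?expR_ge0//.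
rewrite expRN ler_pdivrMr ?expR_gt0// mul1r.
have L10 : 0 <= L / 10 by lra.
apply: le_trans (expR_ge1Dxn 1 L10).
rewrite (_ : 2`!%:R = 2 :> R)// expr2.
suff : 200 * (96 * L) <= L * L by lra.
by rewrite mulrA ler_wpM2r//; lra.
Qed.

Lemma div64_bounds n (d := (n %/ 64)%N) : (400 <= n)%N ->
  [/\ (0 < d)%N, (2 * d <= n)%N, (4 * d <= n)%N, (16 * (4 * d) <= n)%N &
      (n <= 128 * d)%N].
Proof. by rewrite /d => n400; split; lia. Qed.

Lemma nonrigid_le (R : realType) n d (a b : 'I_('C(n, 2)).+1) :
  (0 < d)%N -> (2 * d <= n)%N ->
  pr R (fun g : trajectory n => ~~ `[<globally_rigid R (g (hitting_time 2 g))>]) <=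
  pr R (no_isolated a) + pr R (has_low_degree b) +
  (pr R (has_hole d a) + pr R (has_sparse_cut d a b)).
Proof.
move=> d0 dn.
apply: le_trans (lerD (pr_or _ _ _) (pr_or _ _ _)).
apply: le_trans (pr_or _ _ _); apply: le_pr => g gR.
apply: contraR; rewrite !negb_or => /andP[/andP[i l] /andP[h s]].
by apply/asboolP; apply: hitting_time_rigid i l h s.
Qed.

Lemma four_le_expR2 (R : realType) : 4 <= expR 2 :> R.
Proof.
have e1 : 2 <= expR 1 :> R by apply: le_trans (expR_ge1Dx _).
rewrite (_ : 2 = 1 + 1 :> R)// expRD.
by apply: le_trans (ler_pM _ _ e1 e1); lra.
Qed.

(** With [4] in place of [expR 1], this bounds [kappa * beta] by [96 * L / x]: [beta <= 3 * (x * L)]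
    and [N - beta >= N / 2 >= x * x / 8]. *)
Lemma kappa_beta_le (R : realType) (x L beta N : R) : 1 <= L -> 1 <= x ->
  2 * beta <= N -> beta <= 2 * (x * L) + 1 -> x * x <= 4 * N ->
  4 * beta * x <= 96 * L * (N - beta).
Proof.
move=> L1 x1 bN bx xN.
have xL1 : 1 <= x * L by rewrite -[leLHS]mulr1 ler_pM.
have H1 : 4 * beta * x <= 12 * (x * L) * x by rewrite ler_wpM2r//; lra.
have H2 : 96 * L * (x * x / 8) <= 96 * L * (N - beta) by rewrite ler_wpM2l//; lra.
by lra.
Qed.

(** * Numerical bounds for the four bad events *)

Section Bounds.
Variables (R : realType) (n d : nat) (L : R) (a b : 'I_('C(n, 2)).+1).
Hypothesis expRL : expR L = n%:R.
Hypothesis reg : regime n%:R L a%:R b%:R 'C(n, 2)%:R.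
Hypothesis d_bounds : [/\ (0 < d)%N, (2 * d <= n)%N, (4 * d <= n)%N,
  (16 * (4 * d) <= n)%N & (n <= 128 * d)%N].

Lemma regime_nat :
  [/\ (2 < n)%N, (0 < a <= b)%N, (0 < b < 'C(n, 2))%N & (a < 'C(n, 2))%N].
Proof.
have [_ n_ge N0 _] := regime_basic reg; have [bN b1] := beta_lt_N reg.
have [a1 ab] := alpha_bounds reg.
have ab' : (a <= b)%N by rewrite -(ler_nat R).
have bN' : (b < 'C(n, 2))%N by rewrite -(ltr_nat R); lra.
rewrite bN' ab' (leq_ltn_trans ab' bN') !andbT; split=> //.
- by rewrite -(ltr_nat R); lra.
- by rewrite -(ltr_nat R); lra.
- by rewrite -(ltr_nat R); lra.
Qed.

(** The expected number of isolated vertices at time [a] is at least [expR (L / 20)], and the second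
    moment bound is its inverse. *)
Lemma no_isolated_le : pr R (no_isolated a) <= expR (- (L / 20)).
Proof.
have [qt Lt] := isolated_estimate reg; have aN := alpha_lt_N reg.
have [_ n_ge _ _] := regime_basic reg; have [n2 _ _ _] := regime_nat.
have aN' : (a + 2 * n <= 'C(n, 2))%N.
  by rewrite -(ler_nat R) natrD natrM; exact: aN.
have := prob_no_isolated R n2 aN'.
have -> : n.-1%:R = n%:R - 1 :> R by rewrite -subn1 natrB// (ltn_trans _ n2).
move=> H.
have P : expR (L / 20) <=
    n%:R * \prod_(0 <= i < a) (1 - (n%:R - 1) / ('C(n, 2) - i)%N%:R).
  apply: (@le_trans _ _ (n%:R * expR (- (32 / 15 / n%:R * a%:R)))).
    by rewrite -{1}expRL -expRD ler_expR.
  rewrite ler_wpM2l//; apply: prod_lower qt; first by lra.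
  by lra.
rewrite expRN -[X in _ <= X]mul1r ler_pdivlMr ?expR_gt0//.
by apply: le_trans H; rewrite ler_wpM2l ?pr_ge0.
Qed.

Lemma has_low_degree_le : pr R (has_low_degree b) <= expR (- (L / 20)).
Proof.
have [n2 _ /andP[b_gt0 bN] _] := regime_nat.
have [L0 _ _ _] := regime_basic reg; have est := low_degree_estimate reg.
apply: le_trans (prob_low_degree _ b_gt0 bN) _.
rewrite -expRL -expRM_natr -expRD ler_expR natrB; last exact: ltnW.
by move: est; lra.
Qed.

Lemma has_hole_le : pr R (has_hole d a) <= expR (- (L / 20)).
Proof.
have [_ /andP[a_gt0 _] _ aN] := regime_nat; have [L0 _ _ _] := regime_basic reg.
have [_ _ _ _ d128] := d_bounds.
have xd : n%:R <= 128 * d%:R :> R by rewrite -natrM ler_nat.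
have est := hole_estimate reg xd.
apply: le_trans (prob_hole _ _ a_gt0 aN) _.
apply: (@le_trans _ _ (expR 2 ^+ n * expR (- ((d * d)%N%:R / 'C(n, 2)%:R * a%:R)))).
  by rewrite ler_wpM2r ?expR_ge0// lerXn2r ?nnegrE ?expR_ge0// four_le_expR2.
rewrite -expRM_natr -expRD ler_expR natrM.
by lra.
Qed.

Lemma has_sparse_cut_le :
  pr R (has_sparse_cut d a b) <= 2 * expR (- (L / 20)).
Proof.
have [_ /andP[_ ab] /andP[b_gt0 bN] _] := regime_nat.
have [L0 n_ge N0 _] := regime_basic reg; have [bN2 _] := beta_lt_N reg.
have [_ Nx] := regime_bin_ge reg.
have [[L_ge _] _ _ /andP[_ b_le]] := reg.
have [_ _ d4 d64 _] := d_bounds.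
(* [s] is [n] to the power [- 9 / 20]; [kappa] is the least value that [kN] allows. *)
pose s := expR (- (9 / 20 * L)).
pose kappa := expR 1 / ('C(n, 2) - b)%N%:R : R.
have Nb : ('C(n, 2) - b)%N%:R = 'C(n, 2)%:R - b%:R :> R by rewrite natrB// ltnW.
have Nb0 : 0 < 'C(n, 2)%:R - b%:R :> R by lra.
have kappa0 : 0 <= kappa by rewrite divr_ge0 ?expR_ge0.
have kN : 1 <= kappa * expR (- 1) * ('C(n, 2) - b)%N%:R.
  by rewrite /kappa Nb mulrAC divfK ?gt_eqF// -expRD subrr expR0.
have ks : kappa * b%:R <= s ^+ 2.
  apply: le_trans (ln_over_n_le L_ge).
  rewrite expRN expRL /kappa Nb mulrAC ler_pdivrMr// mulrAC ler_pdivlMr; last first.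
    by lra.
  have e4 : expR 1 * b%:R * n%:R <= 4 * b%:R * n%:R :> R.
    by rewrite ler_wpM2r// ler_wpM2r// expR1_le4.
  apply: le_trans e4 _.
  by apply: kappa_beta_le => //; lra.
have s01 : 0 <= s <= 1.
  by rewrite expR_ge0 /= -[leRHS]expR0 ler_expR; lra.
have Y : n%:R * expR 1 *
    (8 * s * expR (- (7 / 8 * (n - 4 * d)%N%:R / 'C(n, 2)%:R * a%:R))) <=
    expR (- (L / 20)).
  have dx : 16 * (4 * d)%N%:R <= n%:R :> R by rewrite -natrM ler_nat.
  have est := sparse_estimate reg dx.
  apply: (@le_trans _ _ (expR L * 4 * (8 * s * expR (- (5 / 8 * L))))).
    rewrite expRL; apply: ler_pM.
    + by rewrite mulr_ge0 ?expR_ge0.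
    + by rewrite !mulr_ge0 ?expR_ge0.
    + by rewrite ler_wpM2l ?expR_ge0// expR1_le4.
    by rewrite ler_wpM2l ?mulr_ge0 ?expR_ge0// ler_expR lerN2 natrB.
  have -> : expR L * 4 * (8 * s * expR (- (5 / 8 * L))) =
      32 * (expR L * s * expR (- (5 / 8 * L))).
    by ring.
  (* The exponents add up to [1 - 9 / 20 - 5 / 8 = - 3 / 40], split as [- 1 / 40 - 1 / 20]; the
     first part absorbs the constant [32]. *)
  have -> : expR L * s * expR (- (5 / 8 * L)) = expR (- (L / 40)) * expR (- (L / 20)).
    by rewrite /s -!expRD; congr expR; lra.
  rewrite mulrA ler_piMl ?expR_ge0// expRN ler_pdivrMr ?expR_gt0// mul1r.
  by apply: le_trans (expR_ge1Dx _); lra.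
have Y2 := ler_wpM2l (ler0n R 2) Y.
apply: le_trans Y2; apply: prob_sparse_cut ks kN _ => //.
apply: le_trans (ler_wpM2l (ler0n R 2) Y) _.
rewrite expRN ler_pdivrMr ?expR_gt0// mul1r.
by apply: le_trans (expR_ge1Dx _); lra.
Qed.

End Bounds.

(** * Assembly and passage to the limit *)

Lemma prob_rigid_ge (R : realType) n (L := ln n%:R : R) : 400 * 400 <= L ->
  1 - 5 * expR (- (L / 20)) <= process_prob R
    [set g : trajectory n | globally_rigid R (g (hitting_time 2 g))]%classic.
Proof.
move=> LL; have x0 : 0 < n%:R := ln_large_gt0 LL.
have eL : expR L = n%:R := expR_ln_large LL.
have xL := ln_le_natr LL.
(* [a0] rounds down and [b0], by the successor, lands above its target, as [regime] requires. *)
pose a0 := Num.truncn (7 / 16 * (n%:R * L)).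
pose b0 := (Num.truncn (2 * (n%:R * L))).+1.
have reg : regime n%:R L a0%:R b0%:R 'C(n, 2)%:R.
  have L0 : 0 <= L by lra.
  have xL0 : 0 <= n%:R * L by rewrite mulr_ge0.
  have xa : 0 <= 7 / 16 * (n%:R * L) by lra.
  have xb : 0 <= 2 * (n%:R * L) by lra.
  have /andP[a1 a2] := truncn_itv xa.
  have /andP[b1 b2] := truncn_itv xb.
  split=> //; first exact: bin2R.
    by rewrite a1 andbT lerBlDr natr1 ltW.
  by rewrite /b0 ltW//= -natr1 lerD2r.
have [_ n_ge N0 _] := regime_basic reg.
have [bN b1] := beta_lt_N reg; have [a1 ab] := alpha_bounds reg.
have bN' : (b0 < ('C(n, 2)).+1)%N.
  by rewrite -(ltr_nat R) -natr1; move: bN b1; clear; lra.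
have aN' : (a0 < ('C(n, 2)).+1)%N by rewrite (leq_ltn_trans _ bN')// -(ler_nat R).
have n400 : (400 <= n)%N by rewrite -(ler_nat R); move: n_ge; clear; lra.
have d_bounds := div64_bounds n400; have [d0 d2 _ _ _] := d_bounds.
have main := nonrigid_le R (Ordinal aN') (Ordinal bN') d0 d2.
have T1 := no_isolated_le (a := Ordinal aN') (b := Ordinal bN') eL reg.
have T2 := has_low_degree_le (a := Ordinal aN') (b := Ordinal bN') eL reg.
have T3 := has_hole_le (a := Ordinal aN') (b := Ordinal bN') reg d_bounds.
have T4 := has_sparse_cut_le (a := Ordinal aN') (b := Ordinal bN') eL reg d_bounds.
have E : process_prob R
    [set g : trajectory n | globally_rigid R (g (hitting_time 2 g))]%classic =
    pr R (fun g : trajectory n => `[<globally_rigid R (g (hitting_time 2 g))>]).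
  by apply: eq_bigl => g; apply/idP/asboolP; rewrite in_setE.
have := le_trans main (lerD (lerD T1 T2) (lerD T3 T4)); rewrite E pr_not.
by move: (pr R _) (expR _) => p t; clear; lra.
Qed.

Lemma expRN_le_inv (R : realType) (t : R) : 0 < t -> expR (- t) <= t^-1.
Proof.
move=> t0; rewrite expRN lef_pV2 ?posrE ?expR_gt0//.
by apply: le_trans (expR_ge1Dx _); rewrite lerDr.
Qed.

Lemma process_prob_le1 (R : realType) n (A : set (trajectory n)) :
  process_prob R A <= 1.
Proof.
rewrite -(path_prob_sum R (leqnn 'C(n, 2))) /process_prob big_mkcond /=.
by apply: ler_sum => g _; case: ifP => // _; exact: path_prob_ge0.
Qed.

Unset Implicit Arguments.

Local Open Scope classical_set_scope.

Theorem theorem1p2 (R : realType) :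
  (fun n : nat =>
     process_prob R [set g : trajectory n | globally_rigid R (g (hitting_time 2 g))])
    @ \oo --> (1 : R).
Proof.
apply/cvgrPdist_le => e e0.
(* The bound [100 / e] arises from [5 * expR (- (L / 20)) <= 5 * (20 / L)], which is at most [e]
   once [100 / e <= L]. *)
have [M [M1 M2]] : exists M : R, 400 * 400 <= M /\ 100 / e <= M.
  by exists (Num.max (400 * 400) (100 / e)); rewrite !le_max !lexx orbT.
near=> n.
have ML : M <= ln n%:R.
  have n0 : expR M <= n%:R by near: n; exact: nbhs_infty_ger.
  by rewrite -ler_expR lnK// posrE (lt_le_trans (expR_gt0 M)).
have L_ge := le_trans M1 ML.
rewrite ger0_norm ?subr_ge0 ?process_prob_le1//.
rewrite lerBlDl -lerBlDr; apply: le_trans (prob_rigid_ge L_ge).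
rewrite lerD2l lerN2.
have L0 : 0 < ln n%:R / 20 :> R by move: L_ge; clear; lra.
apply: le_trans (ler_wpM2l (ler0n R 5) (expRN_le_inv L0)) _.
rewrite ler_pdivrMr//.
have := le_trans M2 ML; rewrite ler_pdivrMr//.
by lra.
Unshelve. all: by end_near.
Qed.
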